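(* Let $G$ and $H$ be infinite finitely generated groups, and let $p \ge 1$ be real. If $G$ and $H$ embed coarsely into $L_1$, then $G \wr H$ embeds coarsely into $L_p$. Specifically, suppose there are mappings $\psi : H \to L_1$ and $\phi : G \to L_1$ and increasing unbounded functions $\rho_1,\rho_2,\tau_1,\tau_2$ such that $$\rho_1(d_H(x,y)) \leq \|\psi(x) - \psi(y)\|_1 \leq \rho_2(d_H(x,y)) \quad \text{for all } x,y\in H,$$ $$\tau_1(d_G(x,y)) \leq \|\phi(x) - \phi(y)\|_1 \leq \tau_2(d_G(x,y)) \quad \text{for all } x,y\in G.$$ Then there are a mapping $\Phi : G \wr H \to L_p$ and constants $c,C>0$ such that for all $(f,x),(g,y)\in G\wr H$, $$c\,\nu_1\big(d_{G\wr H}((f,x),(g,y))\big) \le \|\Phi(f,x) - \Phi(g,y)\|_p \le C\,\nu_2\big(d_{G\wr H}((f,x),(g,y))\big),$$ where, for nonnegative integers $t$, $$\nu_2(t) = t^{\max\left\{\frac{1}{2},\frac{1}{p}\right\}},$$ $$\nu_1(t) = \left[\min\left\{ \sqrt{\min\left\{ \sum_{k=1}^n \rho_1(s_k) : s_k \geq 0,\ \sum_{k=1}^n s_k = t_1 \right\}} + \sum_{j=2}^m \tau_1(t_j) \;:\; t_j \geq 0,\ \sum_{j=1}^m t_j = t \right\}\right]^{\max\left\{\frac{1}{2},\frac{1}{p}\right\}}.$$ Here the outer minimum is over all $m\ge 1$ and all nonnegative integers $t_1,\dots,t_m$ with sum $t$, and the inner minimum is over all $n \ge 1$ and all nonnegative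 integers $s_1,\dots,s_n$ with sum $t_1$.
   Context: $L_p$ denotes $L_p([0,1])$. A map $f : X \to Y$ between metric spaces is a coarse embedding if there exist increasing unbounded functions $\rho_1,\rho_2 : [0,\infty)\to[0,\infty)$ with $\rho_1(d_X(x,y)) \leq d_Y(f(x),f(y)) \leq \rho_2(d_X(x,y))$ for all $x,y \in X$. Since word metrics take only integer values, the bounding functions are viewed as increasing unbounded functions from the nonnegative integers to $[0,\infty)$, with $0$ mapped to $0$. Wreath product: $G \wr H$ is the group of all pairs $(f,x)$ where $x \in H$ and $f : H \to G$ is finitely supported (i.e. $f(z)=e_G$ for all but finitely many $z\in H$), with product $(f,x)\cdot(g,y) = (z \mapsto f(z)g(x^{-1}z),\, xy)$. Fix finite generating sets $S$ of $G$ and $T$ of $H$; then $G\wr H$ is generated by $\{(\mathbf{e},t): t \in T\} \cup \{(\delta_s,e_H) : s \in S\}$, where $\mathbf{e}$ is the function constantly equal to $e_G$ and $\delta_s$ has value $s$ at $e_H$ and $e_G$ elsewhere. $d_G,d_H,d_{G\wr H}$ are the left-invariant word metrics for these generating sets. *)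

(* Defs.v *)
From HB Require Import structures.
From mathcomp Require Import all_boot all_order all_algebra finmap.
From mathcomp Require Import all_classical all_reals all_analysis.

Set Implicit Arguments.
Unset Strict Implicit.
Unset Printing Implicit Defensive.
Import Order.TTheory GRing.Theory Num.Theory.

Local Open Scope classical_set_scope.
Local Open Scope ring_scope.

(** * Word metrics *)

Section WordMetric.
Context {G : groupType}.
Implicit Types (S : seq G) (g h : G).

Definition letters S : seq G := S ++ [seq (s^-1)%g | s <- S].

Definition has_word S g (n : nat) : Prop :=
  exists w : seq G,
    [/\ size w = n, {subset w <= letters S} & (\prod_(a <- w) a)%g = g].

Definition generates S : Prop := forall g, exists n, has_word S g n.

(* The value [0] outside the subgroup generated by [S] is never used. *)
Definition word_length S g : nat :=
  match pselect (exists n, `[< has_word S g n >]) with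
  | left e => ex_minn e
  | right _ => 0%N
  end.

Definition word_dist S g h : nat := word_length S (g^-1 * h)%g.

End WordMetric.

(** * Wreath products *)

(* The alias hides the product structures of the underlying pair type. *)
Definition wreath (G H : groupType) : Type :=
  ({fsfun H -> G with 1%g} * H)%type.

Section Wreath.
Context {G H : groupType}.
Local Open Scope group_scope.
Local Open Scope fset_scope.

HB.instance Definition _ := Choice.on (wreath G H).

Definition wreath_mul (u v : wreath G H) : wreath G H :=
  ([fsfun z in finsupp u.1 `|` [fset (u.2 * z)%g | z in finsupp v.1]
      => u.1 z * v.1 (u.2^-1 * z) | 1],
   u.2 * v.2).

Definition wreath_one : wreath G H := ([fsfun with 1], 1).

Definition wreath_inv (u : wreath G H) : wreath G H :=
  ([fsfun z in [fset (u.2^-1 * z)%g | z in finsupp u.1]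
      => (u.1 (u.2 * z))^-1 | 1],
   u.2^-1).

Lemma wreath_mulE (u v : wreath G H) (z : H) :
  (wreath_mul u v).1 z = u.1 z * v.1 (u.2^-1 * z).
Proof.
rewrite fsfunE; case: ifPn => //; rewrite inE negb_or => /andP[zu zv].
rewrite (fsfun_dflt zu) mul1g; case: finsuppP => // zv'.
case/imfsetP: zv; exists (u.2^-1 * z) => //; by rewrite mulVKg.
Qed.

Lemma wreath_invE (u : wreath G H) (z : H) :
  (wreath_inv u).1 z = (u.1 (u.2 * z))^-1.
Proof.
rewrite fsfunE; case: ifPn => // zu; case: finsuppP => [_|zu'].
  by rewrite invg1.
by case/imfsetP: zu; exists (u.2 * z) => //; rewrite mulKg.
Qed.

Lemma wreath_eqP (u v : wreath G H) : u.1 =1 v.1 -> u.2 = v.2 -> u = v.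
Proof. by case: u v => [f x] [g y] /= /fsfunP -> ->. Qed.

Fact wreath_mulA : associative wreath_mul.
Proof.
move=> u v w; apply: wreath_eqP => [z|]; last by rewrite /= mulgA.
by rewrite !wreath_mulE /= invgM !mulgA.
Qed.

Fact wreath_mul1g : left_id wreath_one wreath_mul.
Proof.
move=> u; apply: wreath_eqP => [z|]; last by rewrite /= mul1g.
by rewrite wreath_mulE /= fsfun0E mul1g invg1 mul1g.
Qed.

Fact wreath_mulg1 : right_id wreath_one wreath_mul.
Proof.
move=> u; apply: wreath_eqP => [z|]; last by rewrite /= mulg1.
by rewrite wreath_mulE /= fsfun0E mulg1.
Qed.

Fact wreath_mulVg : left_inverse wreath_one wreath_inv wreath_mul.
Proof.
move=> u; apply: wreath_eqP => [z|]; last by rewrite /= mulVg.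
by rewrite wreath_mulE wreath_invE /= invgK mulVg fsfun0E.
Qed.

Fact wreath_mulgV : right_inverse wreath_one wreath_inv wreath_mul.
Proof.
move=> u; apply: wreath_eqP => [z|]; last by rewrite /= mulgV.
by rewrite wreath_mulE wreath_invE /= mulVKg mulgV fsfun0E.
Qed.

HB.instance Definition _ := isGroup.Build (wreath G H)
  wreath_mulA wreath_mul1g wreath_mulg1 wreath_mulVg wreath_mulgV.

Definition wreath_base (t : H) : wreath G H := ([fsfun with 1], t).

Definition wreath_lamp (s : G) : wreath G H :=
  ([fsfun z in [fset 1%g] => s | 1], 1).

Definition wreath_gens (S : seq G) (T : seq H) : seq (wreath G H) :=
  [seq wreath_base t | t <- T] ++ [seq wreath_lamp s | s <- S].

End Wreath.

(** * The spaces L_p([0,1]) *)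

Section Lp.
Context {R : realType}.

(* Lebesgue measure on the line restricted to [0,1]: functions are defined on
   the line, but their values outside [0,1] are irrelevant, as [LspaceType]
   identifies functions that are equal almost everywhere. *)
Definition mu01 : {measure set (measurableTypeR R) -> \bar R} :=
  mrestr lebesgue_measure (measurable_itv `[0 : R, 1]).

Definition Lp (p : R) (p1 : 1 <= p) : Type :=
  @LspaceType _ _ R mu01 p%:E p1.

Definition Lp_dist (p : R) (p1 : 1 <= p) (f g : Lp p1) : R :=
  fine (Lnorm mu01 p%:E (fun x => (f x - g x)%:E)).

End Lp.

Definition L1 (R : realType) : Type := Lp (lexx (1 : R)).

Definition L1_dist {R : realType} (f g : L1 R) : R := Lp_dist f g.

(** * Coarse embeddings *)

Section Coarse.
Context {R : realType}.

(* "Increasing" is read as nondecreasing, the usual convention for coarse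
   embeddings. Nonnegativity follows from the first two conditions. *)
Definition control (rho : nat -> R) : Prop :=
  [/\ rho 0%N = 0, {homo rho : m n / (m <= n)%N >-> m <= n}
    & forall M, exists n, M <= rho n].

(* [dX] is a distance with values in nat, as word metrics are. *)
Definition coarse_bounds (X Y : Type) (dX : X -> X -> nat) (dY : Y -> Y -> R)
    (f : X -> Y) (rho1 rho2 : nat -> R) : Prop :=
  forall x y, rho1 (dX x y) <= dY (f x) (f y) <= rho2 (dX x y).

Definition embeds_coarsely (X Y : Type) (dX : X -> X -> nat)
    (dY : Y -> Y -> R) : Prop :=
  exists (f : X -> Y) (rho1 rho2 : nat -> R),
    [/\ control rho1, control rho2 & coarse_bounds dX dY f rho1 rho2].

(** * The functions nu_1 and nu_2 *)

(* Both infima below are minima if [rho 0 = tau 0 = 0]: zero parts can then be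
   dropped, so only finitely many values occur. *)
Definition min_split (rho : nat -> R) (t : nat) : R :=
  inf [set \sum_(k <- s) rho k
      | s in [set s : seq nat | (0 < size s)%N /\ sumn s = t]].

(* The parts are t_1 = [s.1] and t_2, ..., t_m = [s.2]. *)
Definition min_sqrt_split (rho tau : nat -> R) (t : nat) : R :=
  inf [set Num.sqrt (min_split rho s.1) + \sum_(k <- s.2) tau k
      | s in [set s : nat * seq nat | (s.1 + sumn s.2)%N = t]].

Definition nu_exp (p : R) : R := Num.max (1 / 2) (1 / p).

Definition nu1 (p : R) (rho1 tau1 : nat -> R) (t : nat) : R :=
  min_sqrt_split rho1 tau1 t `^ nu_exp p.

Definition nu2 (p : R) (t : nat) : R := t%:R `^ nu_exp p.

End Coarse.

(* Main.v *)
Require Import Defs.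
From HB Require Import structures.
From mathcomp Require Import all_boot all_order all_algebra finmap.
From mathcomp Require Import all_classical all_reals all_analysis.
From mathcomp Require Import measurable_realfun ring lra zify.

Set Implicit Arguments.
Unset Strict Implicit.
Unset Printing Implicit Defensive.
Import Order.TTheory GRing.Theory Num.Theory numFieldNormedType.Exports.
Local Open Scope classical_set_scope.
Local Open Scope ring_scope.

(** The embedding comes from one kernel [D] on the wreath product, of the form
    [D u v = mu (E_u \Delta E_v)] for measurable sets [E_u] with finite
    symmetric differences; a countable family of numbers of this form is called
    a cut kernel below.

    Construction of [D]. The region below the graph of a function in [L_1]
    determines it, and the measure of the symmetric difference of two such
    regions is the [L_1] distance ([measure_symd_subgraph]). Hence [psi] sends
    [x] in [H] to a set [P x] in the plane, and each point [w] of the plane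
    determines a half-space [A = {x | w \in P x}] of [H]. Let [(f, x)] be marked
    by [w] if [x] is in [A], and record the restriction of [f] to the complement
    of [A] as the colour of the mark. The measure of the set of [w] at which two
    elements of the wreath product carry different marks, counted twice where
    both are marked, in different colours, is a cut kernel. A
    change of the lamp at [x] is invisible to it, since [x] lies in [A]; a step
    from [x] to [x t] costs the measure of the half-spaces that separate the two
    points. Conversely, if [f z <> g z], every half-space that contains [x] but
    not [z] distinguishes [(f, x)] from [(g, y)]. The same is done with the
    complementary half-spaces, and one adds the kernels
    [\sum_z |phi (f z) - phi (g z)|] and [#{z | f z <> g z}] for the lamps.
    The sum [D] is at most a multiple of the word metric, being bounded on the
    generators, and it dominates [rho1 (d (x, z))] for every [z] where the lamps
    differ, the number [k] of these [z], and the sum of the [tau1 (d (f z, g z))]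
    ([wreath_kernel]).

    Lower bound. Going from [x] to each such [z] and back, and finally to [y],
    shows that the word distance is at most
    [d (x, y) + \sum_z (2 d (x, z) + d (f z, g z))]. The values of [rho1] on the
    pieces that lie in [H] add up to at most [D + 2 k D], hence to at most
    [4 D ^ 2] when [1 <= D]; this is why a square root appears in [nu1]
    ([min_sqrt_split_star]).

    From [D] to [L_p([0, 1])]. Only countably many sets occur, so [D] is
    determined by the measures of the atoms of finitely many of them at a time.
    These form a binary tree of masses, which is realised by successively
    subdividing the half-line [t >= 0] into intervals; the substitution
    [x = 1 / (1 + t)] moves it to [0 < x <= 1], and its density [x ^- 2] is
    absorbed by multiplying functions by [x `^ (- 2 / p)] ([Lp_realization]).
    For [p <= 2], indicators have [L_p] distance [D `^ (1 / p)]
    ([cut_kernel_snowflake]). For [p >= 2] one uses that [D] is the square of a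
    Hilbert space distance: a Cholesky factorisation writes
    [D i j = \sum_k (a i k - a j k) ^+ 2] with finite rows [a i]
    ([gram_factorization]), the rows are used as coefficients of Rademacher
    functions, which are realised on [[0, 1]] from the tree of a fair coin, and
    Khinchine's inequality gives [L_p] distance comparable to the square root of
    [D] ([cut_kernel_sqrt]).

    The qualitative statement needs, in addition, that bounded [D] forces bounded
    word distance, which the same estimates show; [nu1] itself would not do here,
    since it vanishes identically if [rho1 1 = 0]. *)

(** * Trees of masses and subdivisions of the half-line *)
Section Content.
Context {R : realType}.
Implicit Types (m : seq bool -> R) (s : seq bool).

(** [m s] is the mass of the points whose successive digits are those of [s], the
    most recent digit being at the head. Additivity is only required below a word
    that contains [true]: words of digits [false] stand for the complement of
    finitely many sets of finite measure, whose mass may be infinite. *)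
Definition content m :=
  (forall s, 0 <= m s) /\
  (forall s, true \in s -> m s = m (true :: s) + m (false :: s)).

(** The left end of the interval of a word. The child [true] comes first, so that
    the mass of the child [false] is never needed to place anything. *)
Fixpoint offset m s : R :=
  match s with
  | [::] => 0
  | b :: s' => if b then offset m s' else offset m s' + m (true :: s')
  end.

Fixpoint address m n t : seq bool :=
  if n is n'.+1 then
    let s := address m n' t in (t < offset m s + m (true :: s)) :: s
  else [::].

Lemma size_address m n t : size (address m n t) = n.
Proof. by elim: n => //= n ->. Qed.

Lemma offset_ge0 m s : content m -> 0 <= offset m s.
Proof. by case=> m0 _; elim: s => //= -[] s ih //; rewrite addr_ge0. Qed.

(** The points with address [s] form an interval of length [m s], or a half-line
    if all digits of [s] are [false]. *)
Lemma addressE m n t s : content m -> 0 <= t -> size s = n ->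
  (address m n t == s) =
  (offset m s <= t) && ((true \in s) ==> (t < offset m s + m s)).
Proof.
case=> m0 mS t0; elim: n s => [|n ih] [|b s]//=; first by rewrite t0.
case=> sn; rewrite eqseq_cons ih// inE.
set a := address m n t.
have [as_|ns] := eqVneq a s; last first.
  rewrite andbC -ih// (negbTE ns) /=.
  apply/esym/negP => /andP[st ts]; move: (ns); rewrite ih// negb_and negb_imply.
  case: b st ts => /= st ts; rewrite -?ltNge.
    move=> /orP[|/andP[tis]]; first by rewrite ltNge st.
    by rewrite mS//; have := m0 (false :: s); lra.
  have := m0 (true :: s) => ?.
  move=> /orP[|/andP[tis]]; first by lra.
  by rewrite tis/= in ts; rewrite mS//; lra.
rewrite as_; move: (as_) => /eqP; rewrite ih// => /andP[st].
case: b => /= ts; rewrite st.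
  by rewrite ts !andbT eqb_id.
rewrite ts andbT.
have -> : (((t < offset m s + m (true :: s)) == false) =
  (offset m s + m (true :: s) <= t)) by rewrite leNgt; case: (_ < _).
case: (leP (offset m s + m (true :: s)) t) => //= _.
apply/esym/implyP => tis; move: ts; rewrite tis/= => ts.
by have := mS _ tis; lra.
Qed.

Lemma tail_address m n k t : drop k (address m (k + n) t) = address m n t.
Proof. by elim: k => [|k ih]; rewrite ?drop0. Qed.

End Content.

(** * Integration on the unit interval *)
Section Weight.
Context {R : realType}.
Local Notation leb := (@lebesgue_measure R).

Lemma integral_inv_sqr (a b : R) : 0 < a -> a <= b ->
  (\int[leb]_(x in `]a, b]) (x ^- 2)%:E = (a^-1 - b^-1)%:E)%E.
Proof.
move=> a0; rewrite le_eqVlt => /predU1P[<-|ab].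
  by rewrite set_itv_ge ?integral_set0 ?subrr//= bnd_simp ltxx.
have c (x : R) : 0 < x -> {for x, continuous (fun y : R => y ^- 2)}.
  move=> x0; apply: (@cvgV _ _ _ _ (fun y : R => y ^+ 2)).
    by rewrite sqrf_eq0 gt_eqF.
  exact: exprn_continuous.
have cV (x : R) : 0 < x -> {for x, continuous (fun y : R => - y^-1)}.
  by move=> x0; apply: cvgN; apply: cvgV => //; rewrite gt_eqF.
have cc : {within `[a, b], continuous (fun y : R => y ^- 2)}.
  apply: continuous_in_subspaceT => x /[!inE]/= /[!in_itv]/= /andP[ax _].
  exact: c (lt_le_trans a0 ax).
rewrite integral_itv_obnd_cbnd; last first.
  apply/measurable_EFinP.
  apply: (@measurable_funS _ _ _ _ `[a, b]%classic) => //.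
    exact: subset_itv_oc_cc.
  exact: subspace_continuous_measurable_fun.
rewrite (@continuous_FTC2 _ _ (fun x => - x^-1))//.
- by rewrite -EFinB opprK addrC.
- split.
  + move=> x /[!in_itv]/= /andP[ax _]; apply: derivableN; apply: derivableV => //.
    by rewrite gt_eqF// (lt_trans a0).
  + by apply: cvg_at_right_filter; apply: cV.
  + by apply: cvg_at_left_filter; apply: cV; apply: lt_trans ab.
- move=> x /[!in_itv]/= /andP[ax _]; have x0 : x != 0 by rewrite gt_eqF// (lt_trans a0).
  rewrite derive1E deriveN; last exact: derivableV.
  by rewrite deriveV// derive_id scaleNr opprK /GRing.scale/= mulr1.
Qed.

Lemma integral_mu01 (f : R -> \bar R) :
  measurable_fun setT f -> (forall x, 0 <= f x)%E ->
  (\int[mu01]_x f x = \int[leb]_(x in `]0%R, 1%R]) f x)%E.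
Proof.
move=> mf f0.
have mI : measurable (~` `]0%R, 1%R] : set R) by apply: measurableC.
rewrite (@ge0_negligible_integral _ _ _ mu01 setT _ f mI)//; last first.
  rewrite /mu01 /= /mrestr.
  apply: (@subset_measure0 _ _ _ leb _ [set 0%R]) => //.
  - exact: measurableI.
  - move=> x/= []; rewrite !in_itv/= => /negP; rewrite negb_and -leNgt => /orP[x0|].
      by case/andP => x0' _; apply/eqP; rewrite eq_le x0 x0'.
    by move=> /negP x1 /andP[_ /x1].
  - exact: lebesgue_measure_set1.
rewrite setTD setCK; apply: eq_measure_integral => A mA A01.
rewrite /mu01/= /mrestr; congr (leb _); apply/setIidl => x /A01/=.
by rewrite !in_itv/= => /andP[/ltW -> ->].
Qed.
End Weight.

(** * Elements of Lp given by functions *)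
Section LpElements.
Context {R : realType}.

Lemma Lnorm_mu01_ae (p : R) (f g : R -> R) :
  measurable_fun setT f -> measurable_fun setT g -> ae_eq mu01 setT f g ->
  Lnorm mu01 p%:E (EFin \o f) = Lnorm mu01 p%:E (EFin \o g).
Proof.
move=> mf mg fg; rewrite unlock; congr (_ `^ _)%E.
have mp (h : R -> R) : measurable_fun setT h ->
    measurable_fun setT (fun x => `|(EFin \o h) x| `^ p)%E.
  move=> mh; apply/measurable_EFinP.
  apply: (measurableT_comp (measurable_powR _)).
  exact: (measurableT_comp (@normr_measurable _ _)).
apply: ae_eq_integral => //; [exact: mp|exact: mp|].
by apply: filterS fg => x /= /[apply] ->.
Qed.

Lemma Lp_of_fun (p : R) (p1 : 1 <= p) (f : R -> R) :
  measurable_fun setT f -> (Lnorm mu01 p%:E (EFin \o f) < +oo)%E ->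
  exists F : Lp p1, ae_eq mu01 setT F f.
Proof.
move=> mf nf.
pose fm : {mfun measurableTypeR R >-> measurableTypeR R} :=
  HB.pack f (isMeasurableFun.Build _ _ (measurableTypeR R) (measurableTypeR R) f mf).
pose q : {mfun_ mu01, measurableTypeR R >-> measurableTypeR R} :=
  (\pi_({mfun_ mu01, measurableTypeR R >-> measurableTypeR R})%qT fm).
have qf : ae_eq mu01 setT q f.
  by have /eqmodP /asboolP := reprK q; apply: filterS => x.
have fin : finite_norm mu01 p%:E q.
  have mq : measurable_fun setT q by exact: (measurable_funPT (repr q)).
  by rewrite /finite_norm (Lnorm_mu01_ae _ mq mf qf).
pose F : Lp p1 := HB.pack q (isFinLebesgue.Build _ _ _ mu01 p%:E p1 q fin).
by exists F.
Qed.

Lemma measurable_Lp (p : R) (p1 : 1 <= p) (F : Lp p1) : measurable_fun setT F.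
Proof. exact: (measurable_funPT (repr (F : {mfun_ mu01, _ >-> _}))). Qed.

Lemma Lp_distE (p : R) (p1 : 1 <= p) (F G : Lp p1) (f g : R -> R) :
  measurable_fun setT f -> measurable_fun setT g ->
  ae_eq mu01 setT F f -> ae_eq mu01 setT G g ->
  Lp_dist F G = fine (Lnorm mu01 p%:E (fun x => (f x - g x)%:E)).
Proof.
move=> mf mg Ff Gg; rewrite /Lp_dist; congr fine.
rewrite -[LHS]/(Lnorm mu01 p%:E (EFin \o (F \- G))) -[RHS]/(Lnorm mu01 p%:E (EFin \o (f \- g))).
apply: Lnorm_mu01_ae; [|exact: measurable_funB|exact: ae_eq_sub].
by apply: measurable_funB; apply: measurable_Lp.
Qed.
End LpElements.

(** * Functions that are constant on the cells of a tree *)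
Section Spread.
Context {R : realType}.
Implicit Types (m : seq bool -> R) (g : seq bool -> R).
Local Notation leb := (@lebesgue_measure R).

(** Vanishing on the words whose cell may have infinite mass. *)
Definition rooted g := forall s, true \notin s -> g s = 0.

(** The image of the interval of [s] under [t |-> 1 / (1 + t)]. *)
Definition cell m (s : seq bool) : set R :=
  [set` `](1 + offset m s + m s)^-1, (1 + offset m s)^-1]].

(** The factor [x `^ (- 2 / p)] turns the density [x ^- 2] of the image of the
    Lebesgue measure of the half-line into the density [1] in [L_p]. *)
Definition spread (p : R) m n g (x : R) : R :=
  if (0 < x) && (x <= 1) then x `^ (- (2 / p)) * g (address m n (x^-1 - 1))
  else 0.

Lemma in_cell m n (s : seq bool) x : content m -> size s = n -> true \in s ->
  (x \in cell m s) = [&& 0 < x, x <= 1 & address m n (x^-1 - 1) == s].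
Proof.
move=> cm sn ts; have p0 := offset_ge0 s cm; have m0 := cm.1 s.
rewrite mem_setE in_itv/=.
have [x0|x0] := ltP 0 x; last first.
  by rewrite ltNge (le_trans x0)// invr_ge0; lra.
have e1 : (x <= (1 + offset m s)^-1) = (offset m s <= x^-1 - 1).
  by rewrite -[x in LHS]invrK lef_pV2 ?posrE ?invr_gt0; [apply/idP/idP; lra|lra|lra].
have e2 : ((1 + offset m s + m s)^-1 < x) = (x^-1 - 1 < offset m s + m s).
  by rewrite -[x in LHS]invrK ltf_pV2 ?posrE ?invr_gt0; [apply/idP/idP; lra|lra|lra].
rewrite e1 e2 /=; have [x1|x1] := leP x 1; last first.
  have : x^-1 < 1 by rewrite invf_lt1.
  by case: (leP (offset m s)) => ?; rewrite ?andbF//; lra.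
have t0 : 0 <= x^-1 - 1 by rewrite subr_ge0 invf_ge1.
by rewrite (addressE cm t0 sn) ts/= andbC.
Qed.

Lemma cell_partition m n g x : content m -> rooted g ->
  (if (0 < x) && (x <= 1) then g (address m n (x^-1 - 1)) else 0) =
  \sum_(s : n.-tuple bool) g s * \1_(cell m s) x.
Proof.
move=> cm g0.
have E (s : n.-tuple bool) : g s * \1_(cell m s) x =
    g s * ([&& 0 < x, x <= 1 & address m n (x^-1 - 1) == s])%:R.
  have [ts|/g0 ->] := boolP (true \in tval s); last by rewrite !mul0r.
  by rewrite indicE (in_cell x cm (size_tuple s) ts).
under eq_bigr do rewrite E.
have [x01|x01] := boolP ((0 < x) && (x <= 1)); last first.
  by rewrite big1// => s _; rewrite andbA (negbTE x01) mulr0.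
set a := address _ _ _.
have ha : size a == n by rewrite size_address.
rewrite (bigD1 (Tuple ha))//= andbA x01 eqxx mulr1 big1 ?addr0// => s.
rewrite -val_eqE/= andbA x01/= => ns.
by rewrite eq_sym (negbTE ns) mulr0.
Qed.

Lemma measurable_cell m s : measurable (cell m s).
Proof. exact: measurable_itv. Qed.

Lemma measurable_spread p m n g : content m -> rooted g ->
  measurable_fun setT (spread p m n g).
Proof.
move=> cm g0; rewrite (_ : spread p m n g = (fun x => x `^ (- (2 / p)) *
    \sum_(s : n.-tuple bool) g s * \1_(cell m s) x)).
  apply: measurable_funM; first exact: measurable_powR.
  apply: measurable_sum => s; apply: measurable_funM => //.
  exact: measurable_indic (measurable_cell _ _).
apply/funext => x; rewrite -cell_partition// /spread.
by case: ifP; rewrite ?mulr0.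
Qed.

Lemma measurable_invsqr_cell m s :
  measurable_fun setT (fun x : R => x ^- 2 * \1_(cell m s) x).
Proof.
apply: measurable_funM; last exact: measurable_indic (measurable_cell _ _).
rewrite (_ : (fun x : R => _) = (fun x => `|x| `^ (- 2))).
  apply: (measurableT_comp (measurable_powR _)).
  exact: normr_measurable.
by apply/funext => x; rewrite powRN powR_mulrn// real_normK// num_real.
Qed.

Lemma integral_cell m s : content m ->
  (\int[leb]_(x in `]0%R, 1%R]) (x ^- 2 * \1_(cell m s) x)%:E = (m s)%:E)%E.
Proof.
move=> cm; have p0 := offset_ge0 s cm; have m0 := cm.1 s.
transitivity (\int[leb]_(x in `]0%R, 1%R]) (((fun x => (x ^- 2)%:E) \_ (cell m s)) x))%E.
  by apply: eq_integral => x _; rewrite epatch_indic/= EFinM.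
rewrite -integral_mkcondr setIidr; last first.
  move=> x; rewrite /cell/= !in_itv/= => /andP[x1 x2]; apply/andP; split.
    by apply: lt_trans x1; rewrite invr_gt0; lra.
  by apply: le_trans x2 _; rewrite invf_le1; lra.
rewrite integral_inv_sqr; first last.
- by rewrite lef_pV2 ?posrE; lra.
- by rewrite invr_gt0; lra.
by rewrite !invrK; congr EFin; lra.
Qed.

Lemma integral_spread (p : R) m n g : 1 <= p -> content m -> rooted g ->
  (\int[mu01]_x (`|spread p m n g x| `^ p)%:E =
   (\sum_(s : n.-tuple bool) `|g s| `^ p * m s)%:E)%E.
Proof.
move=> p1 cm g0; have p0 : p != 0 by rewrite gt_eqF//; lra.
have gp0 : rooted (fun s => `|g s| `^ p).
  by move=> s ts; rewrite g0// normr0 powR0.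
rewrite integral_mu01; last 2 first.
- apply/measurable_EFinP; apply: (measurableT_comp (measurable_powR _)).
  exact: (measurableT_comp (@normr_measurable _ _) (measurable_spread _ _ _ _)).
- by move=> x; rewrite lee_fin powR_ge0.
transitivity (\int[leb]_(x in `]0%R, 1%R]) (\sum_(s : n.-tuple bool)
    ((`|g s| `^ p)%:E * (x ^- 2 * \1_(cell m s) x)%:E)))%E.
  apply: eq_integral => x /[!inE]/=; rewrite in_itv/= => x01.
  rewrite /spread x01.
  under eq_bigr do rewrite -EFinM mulrCA.
  rewrite sumEFin; congr EFin; rewrite -mulr_sumr.
  rewrite -(cell_partition n x cm gp0) x01 normrM powRM//.
  rewrite ger0_norm ?powR_ge0// -powRrM mulNr divfK//.
  by case/andP: x01 => x0 _; rewrite powRN powR_mulrn ?(ltW x0).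
rewrite ge0_integral_sum//; last 2 first.
- move=> s; apply: measurable_funeM; apply/measurable_EFinP.
  exact: measurable_funS (measurable_invsqr_cell m s).
- move=> s x _; rewrite -EFinM lee_fin mulr_ge0 ?powR_ge0//.
  by rewrite mulr_ge0// invr_ge0 sqr_ge0.
rewrite -sumEFin; apply: eq_bigr => s _.
rewrite ge0_integralZl_EFin ?powR_ge0//; last 2 first.
- by move=> x _; rewrite lee_fin mulr_ge0// invr_ge0 sqr_ge0.
- apply/measurable_EFinP; exact: measurable_funS (measurable_invsqr_cell m s).
by rewrite integral_cell// EFinM.
Qed.
End Spread.

(** * Cut kernels *)
Section Realization.
Context {R : realType}.
Implicit Types (m : seq bool -> R) (g : seq bool -> R).

(** The weighted [l_p] spaces of all levels of a tree embed isometrically, and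
    compatibly with refinement, into [L_p]. The compatibility is an equality and
    not merely an equality of norms because the representative is chosen as a
    function of [spread p m n g], which does not change under refinement. *)
Lemma Lp_realization (p : R) (p1 : 1 <= p) m : content m ->
  exists Psi : nat -> (seq bool -> R) -> Lp p1,
    (forall k n g, Psi (k + n)%N (g \o drop k) = Psi n g) /\
    (forall n g h, rooted g -> rooted h ->
      Lp_dist (Psi n g) (Psi n h) =
      (\sum_(s : n.-tuple bool) `|g s - h s| `^ p * m s) `^ p^-1).
Proof.
move=> cm.
have fin n g : rooted g ->
    (Lnorm mu01 p%:E (EFin \o spread p m n g) < +oo)%E.
  by move=> g0; rewrite unlock integral_spread// poweR_EFin ltry.
have z0 : rooted (fun=> 0 : R) by [].
have [F0 _] := Lp_of_fun p1 (measurable_spread p 0 cm z0) (fin 0%N _ z0).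
have ex (f : R -> R) : exists F : Lp p1, forall n g, rooted g ->
    f = spread p m n g -> ae_eq mu01 setT F f.
  have [[n [g [g0 ->]]]|nf] := pselect (exists n g, rooted g /\ f = spread p m n g).
    have [F FP] := Lp_of_fun p1 (measurable_spread p n cm g0) (fin n _ g0).
    by exists F.
  by exists F0 => n g g0 fE; case: nf; exists n, g.
have [F FP'] := choice ex.
have FP n g : rooted g -> ae_eq mu01 setT (F (spread p m n g)) (spread p m n g).
  by move=> g0; exact: (FP' _ _ _ g0 erefl).
exists (fun n g => F (spread p m n g)); split.
  move=> k n g; congr F; apply/funext => x.
  by rewrite /spread/= tail_address.
move=> n g h g0 h0.
rewrite (Lp_distE (measurable_spread p n cm g0) (measurable_spread p n cm h0)
  (FP _ _ g0) (FP _ _ h0)).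
have gh0 : rooted (g \- h) by move=> s ts; rewrite /= g0// h0// subrr.
rewrite (_ : (fun x => _) = EFin \o spread p m n (g \- h)); last first.
  apply/funext => x; rewrite /spread/=.
  by case: ifP => _; rewrite ?subr0// mulrBr.
by rewrite unlock integral_spread// poweR_EFin.
Qed.

Definition bit n i (s : seq bool) := nth false s (n - i.+1).

Lemma bit_drop k n i s : (i < n)%N -> bit n i (drop k s) = bit (k + n) i s.
Proof. by move=> ni; rewrite /bit nth_drop addnBA. Qed.

(** If digit number [i] records the membership in a set [A_i], the sum is the
    measure of the symmetric difference of [A_i] and [A_j]. Only words containing
    [true] contribute, so additivity makes it independent of [n]. *)
Definition is_cut_kernel (D : nat -> nat -> R) :=
  exists2 m, content m & forall i j n, (i < n)%N -> (j < n)%N ->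
    D i j = \sum_(s : n.-tuple bool) (bit n i s != bit n j s)%:R * m s.

Lemma is_cut_kernelD D1 D2 : is_cut_kernel D1 -> is_cut_kernel D2 ->
  is_cut_kernel (fun i j => D1 i j + D2 i j).
Proof.
move=> [m1 [m10 m1S] D1E] [m2 [m20 m2S] D2E]; exists (m1 \+ m2).
  split=> [s|s ts]; first by rewrite addr_ge0.
  by rewrite /= m1S// m2S//; ring.
move=> i j n ni nj; rewrite (D1E i j n)// (D2E i j n)// -big_split/=.
by apply: eq_bigr => s _; rewrite mulrDr.
Qed.

Lemma rooted_nth i : rooted (fun s => (nth false s i)%:R : R).
Proof.
move=> s ts; have [si|si] := ltnP i (size s); last by rewrite nth_default.
by case E: (nth _ _ _) => //; rewrite -E mem_nth in ts.
Qed.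

(** An indicator takes the values 0 and 1 only, so the [p]-th power of the [L_p]
    distance of two indicators is the measure of a symmetric difference. *)
Lemma cut_kernel_snowflake (p : R) (p1 : 1 <= p) D : is_cut_kernel D ->
  exists Phi : nat -> Lp p1, forall i j, Lp_dist (Phi i) (Phi j) = D i j `^ p^-1.
Proof.
move=> [m cm DE]; have [Psi [PsiS PsiE]] := Lp_realization p1 cm.
exists (fun i => Psi i.+1 (fun s => (nth false s 0)%:R)) => i j.
pose n := (maxn i j).+1.
have PhiE k : (k < n)%N ->
    Psi k.+1 (fun s => (nth false s 0)%:R) = Psi n (fun s => (bit n k s)%:R).
  move=> kn; rewrite -(PsiS (n - k.+1)%N) subnK//; congr Psi; apply/funext => s.
  by rewrite /= nth_drop addn0.
have [ni nj] : (i < n)%N /\ (j < n)%N by rewrite !ltnS leq_maxl leq_maxr.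
rewrite !PhiE// PsiE; try exact: rooted_nth.
rewrite (DE i j n)//; congr (_ `^ _); apply: eq_bigr => s _; congr (_ * _).
have p0 : p != 0 by rewrite gt_eqF//; lra.
by case: (bit n i s) (bit n j s) => [] []; rewrite ?subrr ?subr0 ?sub0r ?normrN
  ?normr0 ?normr1 ?powR1 ?powR0.
Qed.
End Realization.

(** * Cut kernels from symmetric differences *)
Section CutMeasure.
Context {R : realType} d (T : measurableType d).
Variable mu : {measure set T -> \bar R}.
Implicit Types (A : nat -> set T).

Definition symd (X : Type) (A B : set X) : set X := (A `\` B) `|` (B `\` A).

Lemma symdP (X : Type) (A B : set X) x : symd A B x <-> ~ (A x <-> B x).
Proof. by rewrite /symd/=; case: (EM (A x)) (EM (B x)) => ? []; tauto. Qed.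

Lemma symdC (X : Type) (A B : set X) : symd A B = symd B A.
Proof. exact: setUC. Qed.

Lemma measurable_symd (B C : set T) :
  measurable B -> measurable C -> measurable (symd B C).
Proof. by move=> mB mC; apply: measurableU; apply: measurableD. Qed.

Fixpoint itinerary A n (x : T) : seq bool :=
  if n is n'.+1 then (x \in A n') :: itinerary A n' x else [::].

Lemma size_itinerary A n x : size (itinerary A n x) = n.
Proof. by elim: n => //= n ->. Qed.

Lemma bit_itinerary A n i x : (i < n)%N -> bit n i (itinerary A n x) = (x \in A i).
Proof.
elim: n => // n ih; rewrite ltnS /bit subSS leq_eqVlt => /predU1P[->|ni].
  by rewrite subnn.
by rewrite -ih// /bit (_ : n - i = (n - i.+1).+1)%N //; lia.
Qed.

Definition atom A (s : seq bool) : set T :=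
  [set x | itinerary A (size s) x = s].

Lemma atom_cons A b s :
  atom A (b :: s) = if b then atom A s `&` A (size s) else atom A s `\` A (size s).
Proof.
by case: b; apply/seteqP; split=> x; rewrite /atom/=; [
  by move=> [/set_mem ? ?]|by move=> [-> /mem_set ->]
 |by move=> [/negbT/negP xA ?]; split=> // xAs; apply: xA; rewrite inE|
  by move=> [-> xA]; rewrite memNset].
Qed.

Lemma measurable_atom A s : (forall i, measurable (A i)) -> measurable (atom A s).
Proof.
move=> mA; elim: s => [|b s ih]; last first.
  by rewrite atom_cons; case: b; [exact: measurableI|exact: measurableD].
by rewrite (_ : atom A [::] = setT)//; apply/seteqP; split.
Qed.

Lemma measure_atoms A n (E : set T) : (forall i, measurable (A i)) -> measurable E ->
  mu E = (\sum_(s : n.-tuple bool) mu (E `&` atom A s))%E.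
Proof.
move=> mA mE; rewrite (@fsbig_seq _ _ _ _ (index_enum _)) ?index_enum_uniq//.
rewrite (_ : [set` _] = setT); last first.
  by apply/seteqP; split => // s _; rewrite /= mem_index_enum.
rewrite -measure_fin_bigcup; last 3 first.
- exact: finite_finset.
- apply/trivIsetP => s t _ _ /eqP st; apply/seteqP; split => // x [[_ xs] [_ xt]].
  apply: st; apply: val_inj => /=; rewrite -[LHS]xs -[RHS]xt.
  by rewrite !size_tuple.
- by move=> s _; apply: measurableI => //; exact: measurable_atom.
congr (mu _); apply/seteqP; split => [x Ex|x [s _ []]//].
have h : size (itinerary A n x) == n by rewrite size_itinerary.
by exists (Tuple h) => //; split => //; rewrite /atom/= size_itinerary.
Qed.

(** The tree of masses records the measures of the atoms of [A 0, ..., A n]. The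
    atom of the words of digits [false] gets mass 0, a finite value that no
    symmetric difference sees. *)
Lemma cut_kernel_of_sets A : (forall i, measurable (A i)) ->
  (forall i, (mu (A i) < +oo)%E) ->
  is_cut_kernel (fun i j => fine (mu (symd (A i) (A j)))).
Proof.
move=> mA fA.
pose m s : R := if true \in s then fine (mu (atom A s)) else 0.
have ms s : measurable (atom A s) by exact: measurable_atom.
have fs s : true \in s -> (mu (atom A s) < +oo)%E.
  elim: s => // b s ih; rewrite inE atom_cons => /predU1P[<-|/ih].
    by apply: le_lt_trans (fA (size s)); apply: measureIr.
  by apply: le_lt_trans; case: b; [apply: measureIl|apply: le_measure; rewrite ?inE//;
    exact: measurableD].
have fn s : true \in s -> mu (atom A s) \is a fin_num.
  by move=> ts; rewrite ge0_fin_numE// fs.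
exists m.
  split=> [s|s ts]; first by rewrite /m; case: ifP => // _; exact: fine_ge0.
  rewrite /m !inE ts/= -fineD//; [|by rewrite fn// inE ts ?orbT..].
  rewrite addeC !atom_cons; congr fine; exact: measureDI.
move=> i j n ni nj; have mE := measurable_symd (mA i) (mA j).
rewrite (measure_atoms n mA mE).
have E (s : n.-tuple bool) : mu (symd (A i) (A j) `&` atom A s) =
    ((bit n i s != bit n j s)%:R * m s)%:E.
  have [bs|bs] := eqVneq (bit n i s) (bit n j s).
    rewrite mul0r (_ : _ `&` _ = set0) ?measure0//.
    apply/seteqP; split => // x [/symdP xE xs]; apply: xE.
    move: bs; rewrite -xs size_tuple !bit_itinerary// => bs.
    by split=> /mem_set; [rewrite bs|rewrite -bs] => /set_mem.
  have ts : true \in tval s.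
    apply: contraT => ts; move: bs.
    have nb k : bit n k s = false.
      rewrite /bit; have [sz|sz] := ltnP (n - k.+1) (size s); last by rewrite nth_default.
      by case E: (nth _ _ _) => //; rewrite -E mem_nth in ts.
    by rewrite !nb.
  rewrite mul1r /m ts fineK ?fn//; congr (mu _); apply/setIidr => x xs; apply/symdP.
  move: bs; rewrite -[tval s]xs size_tuple !bit_itinerary// => /eqP bs xE; apply: bs.
  by apply/idP/idP => /set_mem/xE/mem_set.
under eq_bigr do rewrite E.
by rewrite sumEFin.
Qed.

(** Subtracting a base point makes the sets themselves of finite measure:
    [E i \Delta E 0] and [E j \Delta E 0] have the symmetric difference
    [E i \Delta E j]. *)
Lemma cut_kernel_of_measure (E : nat -> set T) : (forall i, measurable (E i)) ->
  (forall i j, (mu (symd (E i) (E j)) < +oo)%E) ->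
  is_cut_kernel (fun i j => fine (mu (symd (E i) (E j)))).
Proof.
move=> mE fE.
have := @cut_kernel_of_sets (fun i => symd (E i) (E 0%N)).
move=> /(_ (fun i => measurable_symd (mE i) (mE 0%N)) (fun i => fE i 0%N)).
have -> // : (fun i j => fine (mu (symd (symd (E i) (E 0%N)) (symd (E j) (E 0%N))))) =
  (fun i j => fine (mu (symd (E i) (E j)))).
apply/funext => i; apply/funext => j; congr (fine (mu _)).
apply/seteqP; split => x; rewrite !symdP;
  by case: (EM (E i x)) (EM (E j x)) (EM (E 0%N x)) => ? [] ? []; tauto.
Qed.
End CutMeasure.

(** * Cholesky factorisation of Gram kernels *)
Section Gram.
Context {R : realType}.
Implicit Types (K : nat -> nat -> R).

(** Positive semidefiniteness, in the form in which it is inherited by Schur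
    complements: on each initial segment, [K] is a kernel of scalar products in a
    weighted [l_2] space. *)
Definition gram K := forall n, exists (I : finType) (w : I -> R) (f : nat -> I -> R),
  (forall s, 0 <= w s) /\
  forall i j, (i < n)%N -> (j < n)%N -> K i j = \sum_s f i s * f j s * w s.

Lemma gram_diag_ge0 K k : gram K -> 0 <= K k k.
Proof.
move=> /(_ k.+1)[I [w [f [w0 KE]]]]; rewrite KE//.
by apply: sumr_ge0 => s _; rewrite mulr_ge0// -expr2 sqr_ge0.
Qed.

Lemma gram_sym K i j : gram K -> K i j = K j i.
Proof.
move=> /(_ (maxn i j).+1)[I [w [f [w0 KE]]]].
rewrite !KE ?ltnS ?leq_maxl ?leq_maxr//.
by apply: eq_bigr => s _; rewrite (mulrC (f i s)).
Qed.

Lemma gram_row0 K i k : gram K -> K k k = 0 -> K i k = 0.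
Proof.
move=> /(_ (maxn i k).+1)[I [w [f [w0 KE]]]].
rewrite !KE ?ltnS ?leq_maxl ?leq_maxr// => /eqP.
rewrite psumr_eq0; last by move=> s _; rewrite mulr_ge0// -expr2 sqr_ge0.
move=> /allP fk0; apply: big1 => s _.
have := fk0 s (mem_index_enum s); rewrite /= mulf_eq0 -expr2 sqrf_eq0.
by move=> /orP[/eqP->|/eqP->]; rewrite ?mulr0 ?mul0r.
Qed.

(** If [K k k = 0] this is 0, and the Schur complement is [K] itself, whose row
    [k] vanishes already by [gram_row0]. *)
Definition pivot K k i := K i k / Num.sqrt (K k k).

Definition schur K k i j := K i j - pivot K k i * pivot K k j.

Lemma schurE K k i j : gram K -> schur K k i j = K i j - K i k * K j k / K k k.
Proof.
move=> gK; rewrite /schur /pivot mulrACA -invfM -expr2 sqr_sqrtr//.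
exact: gram_diag_ge0.
Qed.

(** Projecting all the vectors orthogonally to vector number [k] changes their
    scalar products into the Schur complement. *)
Lemma gram_schur K k : gram K -> gram (schur K k).
Proof.
move=> gK n; have [I [w [f [w0 KE]]]] := gK (n + k.+1)%N.
exists I, w, (fun i s => f i s - K i k / K k k * f k s); split=> // i j ni nj.
have [kn [ni' nj']] : (k < n + k.+1 /\ i < n + k.+1 /\ j < n + k.+1)%N by lia.
rewrite schurE//.
rewrite (eq_bigr (fun s => f i s * f j s * w s
    - K j k / K k k * (f i s * f k s * w s) - K i k / K k k * (f j s * f k s * w s)
    + K i k / K k k * (K j k / K k k) * (f k s * f k s * w s))); last by move=> s _; ring.
rewrite big_split/= !sumrB -!mulr_sumr -!KE//.
have [k0|k0] := eqVneq (K k k) 0; last by field.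
by rewrite (gram_row0 i gK k0) !(mul0r, mulr0, subr0, addr0).
Qed.

Fixpoint residual K k := if k is k'.+1 then schur (residual K k') k' else K.

Lemma gram_residual K k : gram K -> gram (residual K k).
Proof. by move=> gK; elim: k => //= k; exact: gram_schur. Qed.

Lemma residual0 K k i j : gram K -> (i < k)%N -> residual K k i j = 0.
Proof.
move=> gK; elim: k i j => // k ih i j; rewrite ltnS leq_eqVlt /= => ik.
have gk := gram_residual k gK; rewrite schurE//; move: ik => /predU1P[->|ik]; last first.
  have r0 l : residual K k i l = 0 by exact: ih.
  by rewrite !r0 !mul0r subrr.
have [k0|k0] := eqVneq (residual K k k k) 0.
  by rewrite k0 !mul0r subr0 gram_sym// gram_row0.
by rewrite mulrAC divff// mul1r gram_sym// subrr.
Qed.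

(** The first [n] rows of the kernel are exhausted after [n] eliminations, so that
    the factorisation is a finite sum although there are infinitely many rows. *)
Lemma gram_factorization K : gram K ->
  exists2 a : nat -> nat -> R, (forall i k, (i < k)%N -> a i k = 0) &
    forall i j n, (i < n)%N -> K i j = \sum_(k < n) a i k * a j k.
Proof.
move=> gK; exists (fun i k => pivot (residual K k) k i) => [i k ik|i j n ni].
  by rewrite /pivot (residual0 _ gK ik) mul0r.
have -> : K i j = K i j - residual K n i j by rewrite residual0// subr0.
elim: n {ni} => [|n ih]; first by rewrite big_ord0 /= subrr.
by rewrite big_ord_recr/= -ih /schur; ring.
Qed.

End Gram.

(** * Rademacher averages *)
Section Rademacher.
Context {R : realType}.
Implicit Types (b : nat -> R) (F : R -> R).

(** The mean of [F (\sum_(k < n) +- b k)] over all the choices of signs. *)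
Fixpoint rademacher_mean b n F : R :=
  if n is n'.+1 then
    rademacher_mean b n' (fun x => (F (x + b n') + F (x - b n')) / 2)
  else F 0.
Local Notation E := rademacher_mean.

Lemma le_rademacher b n F1 F2 : (forall x, F1 x <= F2 x) -> E b n F1 <= E b n F2.
Proof.
elim: n F1 F2 => //= n ih F1 F2 F12; apply: ih => x.
by rewrite ler_pM2r ?invr_gt0// lerD.
Qed.

Lemma eq_rademacher b n F1 F2 : F1 =1 F2 -> E b n F1 = E b n F2.
Proof. by move=> /funext ->. Qed.

Lemma rademacherD b n F1 F2 : E b n (F1 \+ F2) = E b n F1 + E b n F2.
Proof.
elim: n F1 F2 => //= n ih F1 F2; rewrite -ih; apply: eq_rademacher => x /=; lra.
Qed.

Lemma rademacherZ b n c F : E b n (fun x => c * F x) = c * E b n F.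
Proof.
elim: n F => //= n ih F; rewrite -ih; apply: eq_rademacher => x /=; lra.
Qed.

Lemma rademacher_cst b n c : E b n (fun=> c) = c.
Proof. by elim: n => //= n ih; rewrite -[RHS]ih; apply: eq_rademacher => x; lra. Qed.

Lemma rademacher_sqr b n : E b n (fun x => x ^+ 2) = \sum_(k < n) b k ^+ 2.
Proof.
elim: n => [|n ih]; first by rewrite big_ord0/= expr0n.
rewrite big_ord_recr/= -ih -[b n ^+ 2 in RHS](rademacher_cst b n) -rademacherD.
by apply: eq_rademacher => x /=; lra.
Qed.

Lemma rademacher_eq0 b n F : (forall k, (k < n)%N -> b k = 0) -> E b n F = F 0.
Proof.
elim: n F => //= n ih F b0; rewrite ih => [|k kn]; last exact/b0/ltnW.
by rewrite b0// subr0 addr0; lra.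
Qed.

(** For [x ^+ 2 >= 1 / 4] both exponents are at most [2 * x ^+ 2]; otherwise
    adding the bounds [expR y <= 1 / (1 - y)] for [y = x] and [y = - x] gives
    [2 / (1 - x ^+ 2)]. *)
Lemma cosh_le (x : R) : (expR x + expR (- x)) / 2 <= expR (2 * x ^+ 2).
Proof.
rewrite ler_pdivrMr//.
have [x2|x2] := leP (1/4) (x ^+ 2).
  have x1 : `|x| <= 2 * x ^+ 2.
    rewrite -(@real_normK _ x) ?num_real// expr2 mulrA ler_peMl//.
    have : (1/2) ^+ 2 <= `|x| ^+ 2 by rewrite real_normK ?num_real//; lra.
    by rewrite ler_sqr ?nnegrE//; lra.
  have h y : y <= `|x| -> expR y <= expR (2 * x ^+ 2).
    by move=> yx; rewrite ler_expR (le_trans yx).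
  have := h x (ler_norm x); have := h (- x); rewrite -normrN => /(_ (ler_norm _)).
  lra.
have x1 : `|x| < 1/2.
  by rewrite -ltr_sqr ?nnegrE// real_normK ?num_real//; lra.
move: x1; rewrite ltr_norml => /andP[xl xr].
have h y : - (1/2) < y -> y < 1/2 -> expR y <= (1 - y)^-1.
  move=> yl yr; rewrite -[y in leLHS]opprK expRN lef_pV2 ?posrE ?expR_gt0//; last lra.
  by have := expR_ge1Dx (- y).
have hx : expR x <= (1 - x)^-1 by apply: h; lra.
have hx' : expR (- x) <= (1 + x)^-1 by rewrite -[x in (1 + x)]opprK; apply: h; lra.
have hs : (1 - x)^-1 + (1 + x)^-1 = 2 * (1 - x ^+ 2)^-1.
  by field; rewrite !gt_eqF//; nra.
have hi : (1 - x ^+ 2)^-1 <= 1 + 2 * x ^+ 2.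
  rewrite -[leLHS]mul1r ler_pdivrMr; last by lra.
  have := sqr_ge0 x; nra.
have := expR_ge1Dx (2 * x ^+ 2); lra.
Qed.

(** Averaging over one more sign multiplies the mean of the exponential by a
    hyperbolic cosine. *)
Lemma rademacher_exp b n t :
  E b n (fun x => expR (t * x)) <= expR (2 * t ^+ 2 * \sum_(k < n) b k ^+ 2).
Proof.
elim: n => [|n ih]; first by rewrite big_ord0/= !mulr0 expR0.
rewrite big_ord_recr/= mulrDr expRD.
rewrite (@eq_rademacher _ _ _ (fun x =>
    (expR (t * b n) + expR (- (t * b n))) / 2 * expR (t * x))); last first.
  by move=> x; rewrite mulrDr mulrBr !expRD; lra.
rewrite rademacherZ [leRHS]mulrC ler_pM//.
- by rewrite -(rademacher_cst b n 0); apply: le_rademacher => x; exact: expR_ge0.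
- by have := cosh_le (t * b n); rewrite exprMn mulrA.
Qed.

Lemma powR_le_exp (p : R) : 0 <= p ->
  exists2 C : R, 0 < C & forall x, `|x| `^ p <= C * (expR x + expR (- x)).
Proof.
move=> p0; pose N := Num.bound p; have pN : p <= N%:R by exact/ltW/archi_boundP.
exists (1 + (N`!)%:R); first by rewrite ltr_pwDl.
move=> x.
have e1 : expR `|x| <= expR x + expR (- x).
  by case: (ger0P x) => _; rewrite ?lerDl ?lerDr expR_ge0.
apply: (@le_trans _ _ ((1 + (N`!)%:R) * expR `|x|)); last first.
  by rewrite ler_pM2l// ltr_pwDl.
have [x1|x1] := leP `|x| 1.
  apply: (@le_trans _ _ (1 * 1)).
    have <- : 1 `^ p = 1 * 1 :> R by rewrite powR1 mul1r.
    by apply: ge0_ler_powR => //; rewrite nnegrE.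
  apply: ler_pM => //; first by rewrite lerDl.
  by have := expR_ge1Dx `|x|; have := normr_ge0 x; lra.
have xN : `|x| `^ p <= `|x| ^+ N.
  by rewrite -powR_mulrn//; apply: ler_powR => //; exact: ltW.
apply: (le_trans xN).
have : `|x| ^+ N <= (N`!)%:R * expR `|x|.
  case: N {pN xN} => [|N]; first by rewrite expr0 mul1r -expR0 ler_expR.
  rewrite -ler_pdivrMl ?ltr0n ?fact_gt0// mulrC.
  by have := expR_ge1Dxn N (normr_ge0 x); lra.
have := expR_ge0 `|x|; nra.
Qed.
End Rademacher.

(** * The inequality of Khinchine *)
Section Hilbert.
Context {R : realType}.
Implicit Types (b : nat -> R) (F : R -> R).
Local Notation E := rademacher_mean.

Lemma sum_tuple_cons n (F : seq bool -> R) :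
  \sum_(s : n.+1.-tuple bool) F s =
  \sum_(s : n.-tuple bool) (F (true :: s) + F (false :: s)).
Proof.
rewrite (reindex (fun x : bool * n.-tuple bool => [tuple of x.1 :: x.2]))/=; last first.
  exists (fun s : n.+1.-tuple bool => (thead s, [tuple of behead s])) => [[c s] _|s _].
    by congr (_, _); apply: val_inj.
  by rewrite [RHS]tuple_eta; apply: val_inj.
rewrite -(pair_bigA _ (fun c s => F (c :: tval s)))/= big_bool/=.
by rewrite -big_split.
Qed.

Lemma sum_tuple0 (F : seq bool -> R) : \sum_(s : 0.-tuple bool) F s = F [::].
Proof.
rewrite (big_pred1 [tuple]) => [//|s]; apply/esym/eqP; exact: tuple0.
Qed.

(** The tree of a fair coin. Its first digit, the last one of the list, is
    [true]: it merely selects a cell of mass 1, inside which the following digits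
    are independent. *)
Definition coin (s : seq bool) : R := (last false s)%:R * 2^-1 ^+ (size s).-1.

Lemma content_coin : content coin.
Proof.
split=> [s|[|a s] //= _]; first by rewrite mulr_ge0// exprn_ge0 ?invr_ge0.
by rewrite /coin/= exprS; lra.
Qed.

Definition signed_sum b n (s : seq bool) : R :=
  \sum_(k < n) b k * (-1) ^+ bit n.+1 k.+1 s.

Lemma signed_sum_cons b n c s :
  signed_sum b n.+1 (c :: s) = signed_sum b n s + (-1) ^+ c * b n.
Proof.
rewrite /signed_sum big_ord_recr/=; congr (_ + _).
  apply: eq_bigr => k _; congr (_ * (-1) ^+ nat_of_bool _).
  have kn := ltn_ord k.
  by rewrite /bit (_ : n.+2 - k.+2 = (n.+1 - k.+2).+1)%N //; lia.
by rewrite /bit subnn mulrC.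
Qed.

Lemma sum_signed_sum b n F :
  \sum_(s : n.+1.-tuple bool) F (signed_sum b n s) * coin s = E b n F.
Proof.
elim: n F => [|n ih] F.
  rewrite (@sum_tuple_cons 0 (fun s => F (signed_sum b 0 s) * coin s)).
  rewrite (sum_tuple0 (fun s => F (signed_sum b 0 (true :: s)) * coin (true :: s) +
    F (signed_sum b 0 (false :: s)) * coin (false :: s))).
  by rewrite /coin/= /signed_sum !big_ord0; lra.
rewrite (@sum_tuple_cons n.+1 (fun s => F (signed_sum b n.+1 s) * coin s)).
rewrite /= -ih; apply: eq_bigr => s _; rewrite !signed_sum_cons/=.
have half c : coin (c :: s) = coin s / 2.
  by case/tupleP: s => a s; rewrite /coin/= exprS; lra.
by rewrite !half expr0 expr1 mulN1r mul1r; lra.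
Qed.

(** A substitute for convexity in the lower bound of [khinchine]: applied to
    [y = 2 x ^+ 2 / v], whose mean is 2, it bounds the mean of [y `^ q] below by 1. *)
Lemma powR_ge_sub1 (y q : R) : 0 <= y -> 1 <= q -> y - 1 <= y `^ q.
Proof.
move=> y0 q1; have [y1|y1] := leP 1 y.
  apply: (@le_trans _ _ y); first lra.
  by rewrite -[leLHS]powRr1//; apply: ler_powR.
by apply: le_trans (powR_ge0 _ _); lra.
Qed.

(** The upper bound compares the [p]-th power with the exponential, after
    normalising the variance [v] to 1, and uses [rademacher_exp]. *)
Lemma khinchine (p : R) : 2 <= p -> exists2 C : R, 0 < C & forall b n,
  ((\sum_(k < n) b k ^+ 2) / 2) `^ (p / 2) <= E b n (fun x => `|x| `^ p)
    <= C * (\sum_(k < n) b k ^+ 2) `^ (p / 2).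
Proof.
move=> p2; have [C C0 HC] := @powR_le_exp R p ltac:(lra).
have p0 : p != 0 by rewrite gt_eqF//; lra.
exists (C * (2 * expR 2)); first by rewrite !mulr_gt0 ?expR_gt0.
move=> b n; set v := \sum_(k < n) _; have v0 : 0 <= v by apply: sumr_ge0 => k _; exact: sqr_ge0.
have [vz|vn] := eqVneq v 0.
  rewrite vz mul0r powR0 ?mulf_neq0 ?invr_neq0// mulr0.
  rewrite rademacher_eq0 ?normr0 ?powR0 ?lexx// => k kn.
  apply/eqP; rewrite -sqrf_eq0; move/eqP: vz; rewrite psumr_eq0; last first.
    by move=> i _; exact: sqr_ge0.
  by move/allP => /(_ (Ordinal kn) (mem_index_enum _)).
have {vn}v0 : 0 < v by rewrite lt_neqAle eq_sym vn.
pose s := Num.sqrt v; have s0 : 0 < s by rewrite sqrtr_gt0.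
have sv : s ^+ 2 = v by rewrite sqr_sqrtr// ltW.
have vp : v `^ (p / 2) = s `^ p.
  by rewrite -sv -powR_mulrn ?ltW// -powRrM; congr (_ `^ _); field.
apply/andP; split.
  have : 1 <= (2 / v) `^ (p / 2) * E b n (fun x => `|x| `^ p).
    rewrite -rademacherZ.
    apply: (@le_trans _ _ (E b n (fun x => 2 / v * x ^+ 2 - 1))).
      rewrite (rademacherD _ _ (fun x => 2 / v * x ^+ 2)) rademacherZ rademacher_cst.
      by rewrite rademacher_sqr -/v divfK ?gt_eqF//; lra.
    apply: le_rademacher => x.
    have -> : (2 / v) `^ (p / 2) * `|x| `^ p = (2 / v * x ^+ 2) `^ (p / 2).
      rewrite [RHS]powRM ?sqr_ge0 ?divr_ge0 ?(ltW v0)//; congr (_ * _).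
      rewrite -(@real_normK _ x) ?num_real// -powR_mulrn// -powRrM.
      by congr (_ `^ _); field.
    apply: powR_ge_sub1; last by rewrite ler_pdivlMr//; lra.
    by rewrite mulr_ge0 ?sqr_ge0// divr_ge0// ltW.
  have v2 : 0 <= v / 2 by rewrite divr_ge0// ltW.
  have v2' : 0 <= 2 / v by rewrite divr_ge0// ltW.
  move=> /(ler_wpM2l (powR_ge0 (v / 2) (p / 2))); rewrite mulr1 => /le_trans; apply.
  rewrite mulrA -powRM// (_ : v / 2 * (2 / v) = 1) ?powR1 ?mul1r//.
  by field; rewrite gt_eqF.
pose q := s `^ p * C.
apply: (@le_trans _ _ (E b n (fun x => q * (expR (s^-1 * x) + expR ((- s^-1) * x))))).
  apply: le_rademacher => x; rewrite -mulrA.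
  have -> : `|x| `^ p = s `^ p * `|s^-1 * x| `^ p.
    rewrite -powRM ?(ltW s0)//; congr (_ `^ _).
    by rewrite normrM ger0_norm ?invr_ge0 ?ltW// mulrA divff ?mul1r// gt_eqF.
  by rewrite ler_pM2l ?powR_gt0// mulNr HC.
rewrite rademacherZ rademacherD vp.
have h t : t ^+ 2 = v^-1 -> E b n (fun x => expR (t * x)) <= expR 2.
  move=> tv; apply: le_trans (rademacher_exp b n t) _.
  by rewrite tv -/v -mulrA mulVf ?gt_eqF// mulr1.
have -> : C * (2 * expR 2) * s `^ p = q * (expR 2 + expR 2) by rewrite /q; ring.
rewrite ler_pM2l ?mulr_gt0 ?powR_gt0//.
by apply: lerD; apply: h; rewrite ?sqrrN exprVn sv.
Qed.
End Hilbert.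

(** * Powers of cut kernels in Lp *)
Section CutKernelLp.
Context {R : realType}.
Variables (p : R) (p1 : 1 <= p).

(** A cut kernel is a squared distance between indicators in an [l_2] space; with
    number 0 as origin, their scalar products are given by polarisation. *)
Lemma cut_kernel_gram (D : nat -> nat -> R) : is_cut_kernel D ->
  gram (fun i j => (D i 0%N + D j 0%N - D i j) / 2).
Proof.
move=> [m [m0 _] DE] n; exists {: n.+1.-tuple bool}.
exists (fun s => m (tval s)), (fun i s => (bit n.+1 i (tval s))%:R - (bit n.+1 0 (tval s))%:R).
split=> // i j ni nj; rewrite !(DE _ _ n.+1) ?(leqW ni) ?(leqW nj)//.
rewrite -big_split/= -sumrB mulr_suml; apply: eq_bigr => s _.
by case: (bit _ i s) (bit _ j s) (bit _ 0 s) => [] [] [] /=; lra.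
Qed.

Lemma cut_kernel_diag (D : nat -> nat -> R) i : is_cut_kernel D -> D i i = 0.
Proof.
move=> [m _ DE]; rewrite (DE i i i.+1)//.
by apply: big1 => s _; rewrite eqxx mul0r.
Qed.

Lemma cut_kernel_ge0 (D : nat -> nat -> R) i j : is_cut_kernel D -> 0 <= D i j.
Proof.
move=> [m [m0 _] DE]; rewrite (DE i j (maxn i j).+1) ?ltnS ?leq_maxl ?leq_maxr//.
by apply: sumr_ge0 => s _; rewrite mulr_ge0.
Qed.

Lemma cut_kernel_sqrt (D : nat -> nat -> R) : 2 <= p -> is_cut_kernel D ->
  exists (Phi : nat -> Lp p1) (c C : R), [/\ 0 < c, 0 < C &
    forall i j, c * D i j `^ 2^-1 <= Lp_dist (Phi i) (Phi j) <= C * D i j `^ 2^-1].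
Proof.
move=> p2 cD; have p0 : p != 0 by rewrite gt_eqF//; lra.
have [a a0 aE] := gram_factorization (cut_kernel_gram cD).
have [Psi [PsiS PsiE]] := Lp_realization p1 (@content_coin R).
have [C C0 HC] := khinchine p2.
(* Digit 0 restricts to the cell of mass 1, on which digit [k + 1] is the sign of
   the coefficient number [k]. *)
pose G n i (s : seq bool) : R := (bit n.+1 0 s)%:R * signed_sum (a i) n s.
exists (fun i => Psi i.+2 (G i.+1 i)), (2^-1 `^ 2^-1), (C `^ p^-1).
split; [by rewrite powR_gt0|by rewrite powR_gt0|] => i j.
pose n := (maxn i j).+1.
have [ni nj] : (i < n)%N /\ (j < n)%N by rewrite !ltnS leq_maxl leq_maxr.
have PhiE k : (k < n)%N -> Psi k.+2 (G k.+1 k) = Psi n.+1 (G n k).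
  move=> kn; rewrite -(PsiS (n - k.+1)%N).
  have nE : (n - k.+1 + k.+2 = n.+1)%N by lia.
  rewrite nE; congr Psi; apply/funext => s; rewrite /G/= bit_drop// nE.
  congr (_ * _); rewrite /signed_sum.
  pose F l := a k l * (-1) ^+ bit n.+1 l.+1 s.
  rewrite -[RHS](big_mkord predT F) (big_cat_nat _ kn)//= big_mkord.
  rewrite [X in _ + X]big_nat_cond [X in _ + X]big1 ?addr0 => [|l]; last first.
    by rewrite andbT => /andP[kl _]; rewrite /F a0 ?mul0r.
  apply: eq_bigr => l _; rewrite bit_drop ?nE//.
  by have := ltn_ord l; lia.
have rG k : rooted (G n k).
  by move=> s ts; rewrite /G /bit rooted_nth// mul0r.
rewrite !PhiE// PsiE//.
have -> : \sum_(s : n.+1.-tuple bool) `|G n i s - G n j s| `^ p * coin s =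
    rademacher_mean (fun k => a i k - a j k) n (fun x => `|x| `^ p).
  rewrite -sum_signed_sum; apply: eq_bigr => s _.
  have -> : G n i s - G n j s =
      (bit n.+1 0 s)%:R * signed_sum (fun k => a i k - a j k) n s.
    rewrite /G -mulrBr; congr (_ * _); rewrite /signed_sum -sumrB.
    by apply: eq_bigr => k _; rewrite mulrBl.
  rewrite /coin /bit -nth_last size_tuple subn1 /=.
  by case: (nth _ _ _); rewrite ?mul1r// !mul0r !mulr0.
have DE : D i j = \sum_(k < n) (a i k - a j k) ^+ 2.
  transitivity (\sum_(k < n) a i k * a i k + \sum_(k < n) a j k * a j k
      - (\sum_(k < n) a i k * a j k + \sum_(k < n) a i k * a j k)).
    rewrite -!aE// !(cut_kernel_diag _ cD); lra.
  by rewrite -!big_split/= -sumrB; apply: eq_bigr => k _; ring.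
have /andP[lo hi] := HC (fun k => a i k - a j k) n; rewrite -DE in lo hi.
have D0 := cut_kernel_ge0 i j cD.
have e : p / 2 / p = 2^-1 by field.
have mono x y : 0 <= x -> x <= y -> x `^ p^-1 <= y `^ p^-1.
  by move=> x0 xy; apply: ge0_ler_powR; rewrite ?nnegrE ?invr_ge0//; lra.
apply/andP; split.
  by have := mono _ _ (powR_ge0 _ _) lo; rewrite -powRrM e mulrC powRM ?invr_ge0// mulrC.
have := mono _ _ (le_trans (powR_ge0 _ _) lo) hi.
by rewrite powRM ?powR_ge0 ?(ltW C0)// -powRrM e.
Qed.

Lemma cut_kernel_Lp (D : nat -> nat -> R) : is_cut_kernel D ->
  exists (Phi : nat -> Lp p1) (c C : R), [/\ 0 < c, 0 < C &
    forall i j, c * D i j `^ nu_exp p <= Lp_dist (Phi i) (Phi j)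
                <= C * D i j `^ nu_exp p].
Proof.
move=> cD; have p0 : 0 < p by exact: lt_le_trans p1.
rewrite /nu_exp !div1r; have [p2|p2] := leP 2 p.
  rewrite max_l; first exact: cut_kernel_sqrt.
  by rewrite lef_pV2 ?posrE; lra.
have [Phi PhiE] := cut_kernel_snowflake p1 cD.
exists Phi, 1, 1; split=> // i j; rewrite PhiE max_r ?mul1r ?lexx//.
by rewrite lef_pV2 ?posrE// ltW.
Qed.
End CutKernelLp.

(** * Word lengths *)
Section Words.
Context {G : groupType}.
Implicit Types (S : seq G) (g h : G).
Local Open Scope group_scope.

Lemma has_word1 S : has_word S 1 0.
Proof. by exists [::]; rewrite big_nil. Qed.

Lemma has_wordM S g h m n :
  has_word S g m -> has_word S h n -> has_word S (g * h) (m + n).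
Proof.
move=> [v [<- vS <-]] [w [<- wS <-]]; exists (v ++ w); split.
- by rewrite size_cat.
- by move=> a; rewrite mem_cat => /orP[/vS|/wS].
- by rewrite big_cat.
Qed.

Lemma lettersV S g : g \in letters S -> g^-1 \in letters S.
Proof.
rewrite /letters !mem_cat => /orP[gS|/mapP[s sS ->]].
  by rewrite orbC map_f.
by rewrite invgK sS.
Qed.

Lemma has_word_letter S g : g \in letters S -> has_word S g 1.
Proof.
by move=> gS; exists [:: g]; split; rewrite ?big_seq1// => a /[!inE] /eqP ->.
Qed.

Lemma has_wordV S g n : has_word S g n -> has_word S g^-1 n.
Proof.
move=> [w [<- wS <-]]; elim: w wS => [|a w ih] wS.
  by rewrite big_nil invg1; exact: has_word1.
rewrite big_cons invgM /= -addn1; apply: has_wordM.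
  by apply: ih => b bw; apply: wS; rewrite inE bw orbT.
by apply/has_word_letter/lettersV/wS; rewrite inE eqxx.
Qed.

Lemma has_word_word_length S g : generates S -> has_word S g (word_length S g).
Proof.
move=> /(_ g) [n wn]; rewrite /word_length; case: pselect => [e|[]].
  by case: ex_minnP => k /asboolP.
by exists n; apply/asboolP.
Qed.

Lemma word_length_le S g n : has_word S g n -> (word_length S g <= n)%N.
Proof.
move=> wn; rewrite /word_length; case: pselect => // e.
by case: ex_minnP => k _; apply; apply/asboolP.
Qed.

Lemma word_dist_gen S g s : s \in S -> (word_dist S g (g * s) <= 1)%N.
Proof.
move=> sS; rewrite /word_dist mulKg; apply: word_length_le.
by apply: has_word_letter; rewrite mem_cat sS.
Qed.

(** [D] takes extended values, so that the bound also shows that [D] is finite. *)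
Lemma word_dist_lipschitz (R : realType) S (C : R) (D : G -> G -> \bar R) :
  generates S -> (forall g, D g g = 0%E) -> (forall g h, D g h = D h g) ->
  (forall f g h, D f h <= D f g + D g h)%E ->
  (forall g s, s \in S -> (D g (g * s)%g <= C%:E)%E) ->
  forall g h, (D g h <= (C * (word_dist S g h)%:R)%R%:E)%E.
Proof.
move=> genS D0 Dsym Dtri DS g h.
have DL f a : a \in letters S -> (D f (f * a)%g <= C%:E)%E.
  rewrite mem_cat => /orP[/DS//|/mapP[s sS ->]].
  by rewrite Dsym -[X in D _ X](mulgVK s f); exact: DS.
have [w [sw wS wg]] := has_word_word_length (g^-1 * h) genS.
rewrite -[h in leLHS](mulVKg g) -wg /word_dist -sw.
elim: w wS g {wg sw} => [|a w ih] wS g.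
  by rewrite big_nil mulg1 D0 mulr0.
rewrite big_cons mulgA /= -addn1 natrD mulrDr mulr1 addrC EFinD.
apply: le_trans (Dtri _ (g * a) _) _; apply: leeD.
  by apply: DL; apply: wS; rewrite inE eqxx.
by apply: ih => b bw; apply: wS; rewrite inE bw orbT.
Qed.

Lemma generated_enum S : generates S ->
  exists (code : G -> nat) (decode : nat -> G), cancel code decode.
Proof.
move=> genS; pose L := letters S.
have ex g : exists w : seq nat, \prod_(i <- w) nth 1 L i = g.
  have [n [w [_ wL <-]]] := genS g; exists [seq index a L | a <- w].
  rewrite big_map big_seq [RHS]big_seq; apply: eq_bigr => a /wL aL.
  by rewrite nth_index.
have [f fE] := choice ex.
exists (fun g => choice.pickle (f g)).
exists (fun k => if choice.unpickle k is Some w then \prod_(i <- w) nth 1 L i else 1).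
by move=> g; rewrite choice.pickleK.
Qed.
End Words.

Lemma has_word_morph (G H : groupType) (S : seq G) (T : seq H) (f : G -> H) :
  f 1%g = 1%g -> {morph f : a b / (a * b)%g} -> {subset [seq f s | s <- S] <= T} ->
  forall g n, has_word S g n -> has_word T (f g) n.
Proof.
move=> f1 fM fS g n [w [<- wS <-]].
have fV a : f a^-1%g = (f a)^-1%g.
  by apply: (mulgI (f a)); rewrite -fM !mulgV.
elim: w wS => [|a w ih] wS; first by rewrite big_nil f1; exact: has_word1.
rewrite big_cons fM /= -add1n; apply: has_wordM; last first.
  by apply: ih => b bw; apply: wS; rewrite inE bw orbT.
apply: has_word_letter; have := wS a; rewrite inE eqxx => /(_ isT).
rewrite !mem_cat => /orP[aS|/mapP[s sS ->]]; first by rewrite fS ?map_f.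
by apply/orP; right; apply/mapP; exists (f s); rewrite ?fV// fS ?map_f.
Qed.

(** * Words in wreath products *)
Section WreathWords.
Context {G H : groupType} (S : seq G) (T : seq H).
Hypotheses (genS : generates S) (genT : generates T).
Local Open Scope group_scope.
Local Notation W := (wreath_gens S T).
Implicit Types (u v : wreath G H).

Lemma wreath_mulE1 u v z : (u * v).1 z = u.1 z * v.1 (u.2^-1 * z).
Proof. exact: wreath_mulE. Qed.

Lemma wreath_invE1 u z : (u^-1).1 z = (u.1 (u.2 * z))^-1.
Proof. exact: wreath_invE. Qed.

Lemma wreath_lampE (s : G) z : (wreath_lamp s : wreath G H).1 z = if z == 1 then s else 1.
Proof. by rewrite /wreath_lamp/= fsfunE inE. Qed.

Lemma has_word_base (t : H) : has_word W (wreath_base t) (word_length T t).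
Proof.
apply: (has_word_morph _ _ _ (has_word_word_length t genT)) => //.
- move=> a b; apply: wreath_eqP => // z.
  by rewrite wreath_mulE1 /= !fsfun0E mulg1.
- by move=> x xT; rewrite mem_cat xT.
Qed.

Lemma has_word_lamp (s : G) : has_word W (wreath_lamp s : wreath G H) (word_length S s).
Proof.
apply: (has_word_morph _ _ _ (has_word_word_length s genS)) => //.
- by apply: wreath_eqP => // z; rewrite wreath_lampE fsfun0E; case: eqP.
- move=> a b; apply: wreath_eqP => [z|]; last by rewrite /= mulg1.
  rewrite wreath_mulE1 !wreath_lampE /= invg1 mul1g.
  by case: eqP => // _; rewrite mulg1.
- by move=> x xT; rewrite mem_cat xT orbT.
Qed.

Definition lamp_at (z : H) (s : G) : wreath G H :=
  wreath_base z * wreath_lamp s * wreath_base z^-1.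

Lemma lamp_atE z s z' : (lamp_at z s).1 z' = if z' == z then s else 1.
Proof.
rewrite /lamp_at !wreath_mulE1 wreath_lampE /= !fsfun0E mul1g mulg1.
by rewrite -(inj_eq (mulgI z)) mulVKg mulg1.
Qed.

Lemma lamp_at2 z s : (lamp_at z s).2 = 1.
Proof. by rewrite /lamp_at /= mulg1 mulgV. Qed.

Lemma has_word_lamp_at z s :
  has_word W (lamp_at z s) (word_length T z * 2 + word_length S s).
Proof.
rewrite muln2 -addnn -addnA [(_ + word_length S s)%N]addnC addnA.
apply: has_wordM; first exact/has_wordM/has_word_lamp/has_word_base.
have -> : wreath_base z^-1 = (wreath_base z : wreath G H)^-1.
  apply: (mulgI (wreath_base z : wreath G H)); rewrite mulgV.
  apply: wreath_eqP => [z'|]; last by rewrite /= mulgV.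
  by rewrite wreath_mulE1 /= !fsfun0E mulg1.
exact/has_wordV/has_word_base.
Qed.

Lemma has_word_lamps (r : seq H) (h : H -> G) : uniq r ->
  exists w : wreath G H, [/\ w.2 = 1, forall z, w.1 z = if z \in r then h z else 1
    & has_word W w (\sum_(z <- r) (word_length T z * 2 + word_length S (h z)))].
Proof.
elim: r => [_|z r ih /= /andP[zr /ih[w [w2 w1 ww]]]].
  by exists 1; split=> // [z|]; rewrite ?fsfun0E ?big_nil//; exact: has_word1.
exists (lamp_at z (h z) * w); split.
- by rewrite -[LHS]/((lamp_at z (h z)).2 * w.2) lamp_at2 w2 mulg1.
- move=> z'; rewrite wreath_mulE1 lamp_atE lamp_at2 invg1 mul1g w1 inE.
  by case: eqP => [->|_]; rewrite ?(negbTE zr) ?mulg1// mul1g.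
- by rewrite big_cons; apply: has_wordM => //; exact: has_word_lamp_at.
Qed.

(** From the position of [u], go to each place where the lamps differ, correct the
    lamp, and return; then go to the position of [v]. *)
Lemma has_word_star u v (r : seq H) : uniq r ->
  (forall z, (z \in r) = (u.1 z != v.1 z)) ->
  has_word W (u^-1 * v) (\sum_(z <- r) (word_dist T u.2 z * 2
    + word_dist S (u.1 z) (v.1 z)) + word_dist T u.2 v.2).
Proof.
move=> ur rE; pose h z := (u.1 (u.2 * z))^-1 * v.1 (u.2 * z).
have ur' : uniq [seq u.2^-1 * z | z <- r] by rewrite map_inj_uniq//; exact: mulgI.
have [w [w2 w1 ww]] := has_word_lamps h ur'.
have -> : u^-1 * v = w * wreath_base (u.2^-1 * v.2).
  apply: wreath_eqP => [z|]; last by rewrite /= w2 mul1g.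
  rewrite !wreath_mulE1 wreath_invE1 w1 /= fsfun0E mulg1 invgK -/(h z).
  case: ifPn => // zr; rewrite /h.
  suff /eqP -> : u.1 (u.2 * z) == v.1 (u.2 * z) by rewrite mulVg.
  rewrite -[_ == _]negbK -rE; apply: contra zr => zr.
  by apply/mapP; exists (u.2 * z) => //; rewrite mulKg.
apply: has_wordM; last exact: has_word_base.
move: ww; rewrite big_map; congr has_word; apply: eq_bigr => z _.
by rewrite /word_dist /h mulVKg.
Qed.

Lemma diff_support u v : exists2 r : seq H, uniq r &
  forall z, (z \in r) = (u.1 z != v.1 z).
Proof.
exists [seq z <- undup (finsupp u.1 ++ finsupp v.1) | u.1 z != v.1 z].
  by rewrite filter_uniq ?undup_uniq.
move=> z; rewrite mem_filter mem_undup mem_cat andbC.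
case: finsuppP => //= _; case: finsuppP => //= _; by rewrite eqxx.
Qed.

Lemma generates_wreath : generates W.
Proof.
move=> v; have [r ur rE] := diff_support 1 v.
by have := has_word_star ur rE; rewrite invg1 mul1g => hw; eexists; exact: hw.
Qed.

Lemma wreath_dist_le u v (r : seq H) : uniq r ->
  (forall z, (z \in r) = (u.1 z != v.1 z)) ->
  (word_dist W u v <= \sum_(z <- r) (word_dist T u.2 z * 2
    + word_dist S (u.1 z) (v.1 z)) + word_dist T u.2 v.2)%N.
Proof. by move=> ur rE; apply/word_length_le/has_word_star. Qed.

End WreathWords.

(** * Families of sets in countably many layers *)
Section Layers.
Context {R : realType} d (Om : measurableType d).
Variable mu : {measure set Om -> \bar R}.
Local Open Scope ereal_scope.

(** The measure [mu] on the copy number [k] of [Om] inside [Om * nat]. *)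
Definition sheet (k : nat) (A : set (Om * nat)) : \bar R := mu (ysection A k).

Let sheet0 k : sheet k set0 = 0.
Proof. by rewrite /sheet ysection0 measure0. Qed.

Let sheet_ge0 k A : 0 <= sheet k A.
Proof. exact: measure_ge0. Qed.

Let sheet_sigma_additive k : semi_sigma_additive (sheet k).
Proof.
move=> F mF tF mUF; rewrite /sheet ysection_bigcup.
apply: measure_semi_sigma_additive.
- by move=> n; exact: measurable_ysection.
- exact: trivIset_ysection.
- by rewrite -ysection_bigcup; exact: measurable_ysection.
Qed.

HB.instance Definition _ k := isMeasure.Build _ _ _ (sheet k)
  (sheet0 k) (sheet_ge0 k) (@sheet_sigma_additive k).

Definition stack (A : nat -> set Om) : set (Om * nat) := [set wk | A wk.2 wk.1].

Lemma measurable_stack A : (forall k, measurable (A k)) -> measurable (stack A).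
Proof.
move=> mA; rewrite (_ : stack A = \bigcup_k (A k `*` [set k])).
  by apply: bigcup_measurable => k _; exact: measurableX.
apply/seteqP; split=> [[w k] /= Akw|[w k] [j _ [/= Ajw kj]]]; first by exists k.
by rewrite /stack/= kj.
Qed.

Definition layer_dist (A B : nat -> set Om) : \bar R :=
  \sum_(0 <= k <oo) mu (symd (A k) (B k)).

Lemma mseries_sheet A B :
  mseries sheet 0 (symd (stack A) (stack B)) = layer_dist A B.
Proof.
apply: eq_eseriesr => k _; congr (mu _).
by apply/seteqP; split => w; rewrite /ysection/= inE.
Qed.

Lemma layer_dist_ge0 A B : 0 <= layer_dist A B.
Proof. by apply: nneseries_ge0 => k _ _; exact: measure_ge0. Qed.

Lemma layer_distxx A : layer_dist A A = 0.
Proof.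
apply: eseries0 => k _ _; rewrite (_ : symd _ _ = set0) ?measure0//.
by apply/seteqP; split => // w /symdP; apply.
Qed.

Lemma layer_distC A B : layer_dist A B = layer_dist B A.
Proof. by apply: eq_eseriesr => k _; rewrite symdC. Qed.

Lemma layer_distD A B C : (forall k, measurable (A k)) ->
  (forall k, measurable (B k)) -> (forall k, measurable (C k)) ->
  layer_dist A C <= layer_dist A B + layer_dist B C.
Proof.
move=> mA mB mC; rewrite /layer_dist -nneseriesD//.
apply: lee_nneseries => [k _ _|k _]; first exact: measure_ge0.
apply: (@le_trans _ _ (mu (symd (A k) (B k) `|` symd (B k) (C k)))).
  apply: le_measure; rewrite ?inE//.
  - exact: measurable_symd.
  - by apply: measurableU; exact: measurable_symd.
  - move=> w; rewrite /setU/= !symdP.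
    by case: (EM (A k w)) (EM (B k w)) (EM (C k w)) => ? [] ? [] ?; tauto.
by apply: measureU2; exact: measurable_symd.
Qed.

Lemma layer_cut_kernel (E : nat -> nat -> set Om) :
  (forall i k, measurable (E i k)) ->
  (forall i j, layer_dist (E i) (E j) < +oo) ->
  is_cut_kernel (fun i j => fine (layer_dist (E i) (E j))).
Proof.
move=> mE fE.
have := @cut_kernel_of_measure R _ _ (mseries sheet 0) (fun i => stack (E i)).
have -> : (fun i j => fine (mseries sheet 0 (symd (stack (E i)) (stack (E j))))) =
    (fun i j => fine (layer_dist (E i) (E j))).
  by apply/funext => i; apply/funext => j; rewrite mseries_sheet.
apply=> [i|i j]; first exact: measurable_stack.
by rewrite /= mseries_sheet.
Qed.

(** For bounding [layer_dist] above: it is then the measure of a union. *)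
Lemma disjoint_layers_le (F : nat -> set Om) (B : set Om) :
  (forall k, measurable (F k)) -> trivIset setT F -> measurable B ->
  (forall k, F k `<=` B) -> \sum_(0 <= k <oo) mu (F k) <= mu B.
Proof.
move=> mF tF mB FB; rewrite -measure_semi_bigcup//; last exact: bigcup_measurable.
apply: le_measure; rewrite ?inE//; first exact: bigcup_measurable.
by move=> w [k _ /FB].
Qed.

Lemma sum_uniq_le_nneseries (F : nat -> \bar R) (ks : seq nat) :
  (forall k, 0 <= F k) -> uniq ks -> \sum_(k <- ks) F k <= \sum_(0 <= k <oo) F k.
Proof.
move=> F0 uks; rewrite nneseries_esumT//; apply: esum_ge.
exists [set` ks]; first by split => //; exact: finite_seq.
by rewrite -fsbig_seq.
Qed.

End Layers.

(** * Marks on wreath products *)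
Section WreathLayers.
Context {R : realType} {G H : groupType} d (Om : measurableType d).
Variable mu : {measure set Om -> \bar R}.
Implicit Types (u v : wreath G H).
Local Open Scope group_scope.

(** A point [w] of [Om] stands for the half-space of all [x] with [P x w]. *)
Section Base.
Variables (P : H -> set Om) (code : wreath G H -> nat).
Hypotheses (mP : forall x, measurable (P x)) (codeI : injective code).

(** The lamps outside the half-space of [w]. They are encoded as an element of the
    wreath product, so as to be numbered by the same [code]. *)
Definition masked (w : Om) u : wreath G H :=
  ([fsfun z in finsupp u.1 => if `[< P z w >] then 1 else u.1 z | 1], 1).

Lemma maskedE w u z : (masked w u).1 z = if `[< P z w >] then 1 else u.1 z.
Proof.
rewrite /masked/= fsfunE; case: ifPn => // zu.
by rewrite (fsfun_dflt zu); case: ifP.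
Qed.

Lemma maskedP w u v : masked w u = masked w v <->
  (forall z, ~ P z w -> u.1 z = v.1 z).
Proof.
split=> [uv z Pz|uv].
  by have := congr1 (fun a : wreath G H => a.1 z) uv; rewrite /= !maskedE asboolF.
apply: wreath_eqP => // z; rewrite !maskedE; case: asboolP => // Pz; exact: uv.
Qed.

(** The half-spaces that contain the position of [u], sorted by the lamps of [u]
    outside. *)
Definition base_layer u (k : nat) : set Om :=
  [set w | P u.2 w /\ code (masked w u) = k].

Lemma measurable_base_layer u k : measurable (base_layer u k).
Proof.
apply: measurableI => //; rewrite -[X in measurable X]/[set w | code (masked w u) = k].
have [[g gk]|ng] := pselect (exists g, code g = k); last first.
  rewrite (_ : [set _ | _] = set0); first exact: measurable0.
  by apply/seteqP; split => // w/= wk; case: ng; exists (masked w u).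
have [g1|g1] := eqVneq g.2 1; last first.
  rewrite (_ : [set _ | _] = set0); first exact: measurable0.
  apply/seteqP; split => // w/=; rewrite -gk => /codeI wg.
  by case/eqP: g1; rewrite -wg.
rewrite (_ : [set _ | _] = \bigcap_(z in [set` (finsupp u.1 `|` finsupp g.1)%fset])
    [set w | (if `[< P z w >] then 1 else u.1 z) = g.1 z]).
  apply: fin_bigcap_measurable => [|z _]; first exact: finite_fset.
  have [uz|uz] := pselect (u.1 z = g.1 z); have [gz|gz] := pselect (1 = g.1 z).
  - rewrite (_ : [set _ | _] = setT); first exact: measurableT.
    by apply/seteqP; split => // w _ /=; case: ifP.
  - rewrite (_ : [set _ | _] = ~` P z); first exact: measurableC.
    by apply/seteqP; split => w /=; case: asboolP.
  - rewrite (_ : [set _ | _] = P z) //.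
    by apply/seteqP; split => w /=; case: asboolP.
  - rewrite (_ : [set _ | _] = set0); first exact: measurable0.
    by apply/seteqP; split => // w /=; case: asboolP.
rewrite -gk; apply/seteqP; split => [w /= /codeI <- z _|w /= wz].
  by rewrite maskedE.
congr code; apply: wreath_eqP => [z|]; last by rewrite g1.
rewrite maskedE; have [zu|zu] := boolP (z \in (finsupp u.1 `|` finsupp g.1)%fset).
  exact: wz.
move: zu; rewrite in_fsetU negb_or => /andP[zu zg].
by rewrite (fsfun_dflt zu) (fsfun_dflt zg); case: ifP.
Qed.

Local Notation dist u v := (layer_dist mu (base_layer u) (base_layer v)).

(** A half-space that contains both positions carries the same colour for both,
    since the lamps are the same. *)
Lemma base_dist_move u x :
  (dist u (u.1, x) <= mu (symd (P u.2) (P x)))%E.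
Proof.
apply: disjoint_layers_le.
- by move=> k; apply: measurable_symd; exact: measurable_base_layer.
- apply/trivIsetP => i j _ _ /eqP ij; apply/seteqP; split => // w [].
  move=> [[[_ ei] _]|[[_ ei] _]] [[[_ ej] _]|[[_ ej] _]];
    by apply: ij; rewrite -ei -ej.
- exact: measurable_symd.
- move=> k w /symdP/= E; apply/symdP => E'; apply: E.
  by split=> -[/E'].
Qed.

(** The lamp at the position of [u] is inside every half-space that is counted. *)
Lemma base_dist_lamp u v : u.2 = v.2 -> (forall z, z != u.2 -> u.1 z = v.1 z) ->
  dist u v = 0%E.
Proof.
move=> uv2 uv1; have E w : P u.2 w -> masked w u = masked w v.
  by move=> Pw; apply/maskedP => z Pz; apply: uv1; apply: contra_not_neq Pz => ->.
rewrite (_ : base_layer v = base_layer u) ?layer_distxx//.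
apply/funext => k; apply/seteqP; split => w [].
  by rewrite -uv2 => Pw <-; split=> //; rewrite E.
by move=> Pw <-; split; [rewrite -uv2|rewrite E].
Qed.

(** A half-space that contains [u.2] but not [z] either misses [v.2], or shows
    the difference between the lamps at [z]. *)
Lemma base_dist_ge u v z : u.2 = z \/ u.1 z <> v.1 z \/ v.2 = z ->
  (mu (P u.2 `\` P z) <= dist u v)%E.
Proof.
move=> h; apply: measure_sigma_subadditive.
- by move=> k; apply: measurable_symd; exact: measurable_base_layer.
- exact: measurableD.
move=> w [Pu Pz]; exists (code (masked w u)) => //.
apply/symdP => /= -[+ _] => /(_ (conj Pu erefl))[Pv /codeI/maskedP vu].
by case: h => [uz|[uz|vz]]; [rewrite uz in Pu|apply: uz; rewrite vu|rewrite vz in Pv].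
Qed.

End Base.

Section Lamp.
Variables (P : G -> set Om) (code : H -> nat).
Hypotheses (mP : forall a, measurable (P a)) (codeI : injective code).

(** One copy of the family [P] for each place [z] of [H]. *)
Definition lamp_layer u (k : nat) : set Om :=
  [set w | exists2 z, code z = k & P (u.1 z) w].

Lemma lamp_layer_code u z : lamp_layer u (code z) = P (u.1 z).
Proof.
by apply/seteqP; split => w /= => [[z' /codeI ->]|Pw] //; exists z.
Qed.

Lemma lamp_layer_nocode u k : ~ (exists z, code z = k) -> lamp_layer u k = set0.
Proof. by move=> nk; apply/seteqP; split => // w [z zk]; case: nk; exists z. Qed.

Lemma measurable_lamp_layer u k : measurable (lamp_layer u k).
Proof.
have [[z <-]|nk] := pselect (exists z, code z = k); first by rewrite lamp_layer_code.
by rewrite lamp_layer_nocode.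
Qed.

Local Notation dist u v := (layer_dist mu (lamp_layer u) (lamp_layer v)).

Lemma lamp_dist_move u x : dist u (u.1, x) = 0%E.
Proof. exact: layer_distxx. Qed.

Lemma lamp_dist_lamp u v x : (forall z, z != x -> u.1 z = v.1 z) ->
  (dist u v <= mu (symd (P (u.1 x)) (P (v.1 x))))%E.
Proof.
move=> uv; have E k : k != code x -> lamp_layer u k = lamp_layer v k.
  move=> kx; have [[z zk]|nk] := pselect (exists z, code z = k); last first.
    by rewrite !lamp_layer_nocode.
  rewrite -zk !lamp_layer_code uv//; apply: contra_neq kx => <-; exact/esym.
have E0 k : k != code x -> symd (lamp_layer u k) (lamp_layer v k) = set0.
  by move=> /E ->; apply/seteqP; split => // w /symdP; apply.
apply: disjoint_layers_le.
- by move=> k; apply: measurable_symd; exact: measurable_lamp_layer.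
- apply/trivIsetP => i j _ _ ij; have [ix|ix] := eqVneq i (code x).
    by rewrite (E0 j) ?setI0// -ix eq_sym.
  by rewrite (E0 i)// set0I.
- exact: measurable_symd.
- move=> k; have [->|kx] := eqVneq k (code x); last by rewrite E0.
  by rewrite !lamp_layer_code.
Qed.

Lemma lamp_dist_ge u v (r : seq H) : uniq r ->
  (\sum_(z <- r) mu (symd (P (u.1 z)) (P (v.1 z))) <= dist u v)%E.
Proof.
move=> ur; rewrite [leLHS](_ : _ = \sum_(k <- [seq code z | z <- r])
    mu (symd (lamp_layer u k) (lamp_layer v k)))%E; last first.
  by rewrite big_map; apply: eq_bigr => z _; rewrite !lamp_layer_code.
by apply: sum_uniq_le_nneseries => //; rewrite map_inj_uniq.
Qed.

End Lamp.
End WreathLayers.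

(** * Half-spaces from maps into L1 *)
Section CutMeasures.
Context {R : realType}.
Local Notation leb := (@lebesgue_measure R).

Definition subgraph (f : R -> R) : set (measurableTypeR R * measurableTypeR R) :=
  [set ws | ws.2 < f ws.1].

Definition plane_measure : {measure set (measurableTypeR R * measurableTypeR R) -> \bar R} :=
  (mu01 \x leb)%E.

Lemma measurable_subgraph f : measurable_fun setT f -> measurable (subgraph f).
Proof.
move=> mf; rewrite (_ : subgraph f = (fun ws => f ws.1 - ws.2) @^-1` `]0, +oo[%classic).
  rewrite -[X in measurable X]setTI.
  have : measurable_fun setT (fun ws : measurableTypeR R * measurableTypeR R =>
      f ws.1 - ws.2).
    by apply: measurable_funB => //; apply: measurableT_comp.
  by apply => //; exact: measurable_itv.
by apply/seteqP; split => ws; rewrite /subgraph/= in_itv/= andbT subr_gt0.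
Qed.

(** The sections of [subgraph f] are rays. *)
Lemma measure_symd_ray (a b : R) :
  leb (symd [set s | s < a] [set s | s < b]) = `|a - b|%:E.
Proof.
wlog ab : a b / a <= b => [h|].
  by case: (leP a b) => [/h//|/ltW/h]; rewrite symdC distrC.
rewrite (_ : symd _ _ = [set` `[a, b[]); last first.
  apply/seteqP; split => s; rewrite /symd/= in_itv/=.
    by move=> [[sa /negP]|[sb /negP]]; rewrite -leNgt => h; [lra|rewrite h].
  by move=> /andP[h1 h2]; right; split => //; apply/negP; rewrite -leNgt.
rewrite lebesgue_measure_itv/= lte_fin; case: ltP => [_|ba].
  by rewrite distrC ger0_norm ?subr_ge0// EFinB.
have -> : a = b by apply/eqP; rewrite eq_le ab.
by rewrite subrr normr0.
Qed.

Lemma measure_symd_subgraph (f g : L1 R) :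
  plane_measure (symd (subgraph f) (subgraph g)) = (L1_dist f g)%:E.
Proof.
transitivity (\int[mu01]_w `|f w - g w|%:E)%E.
  apply: eq_integral => w _; rewrite -measure_symd_ray; congr (leb _).
  by apply/seteqP; split => s; rewrite /xsection/= inE.
rewrite /L1_dist /Lp_dist Lnorm1 fineK//.
have mn (h : L1 R) : measurable_fun setT (fun w => `|h w|%:E).
  by apply/measurable_EFinP; apply: measurableT_comp => //; exact: measurable_Lp.
have fin (h : L1 R) : (\int[mu01]_w `|h w|%:E < +oo)%E.
  by have := @Lebesgue_finite _ _ _ _ _ _ h; rewrite /finite_norm Lnorm1.
rewrite ge0_fin_numE; last exact: integral_ge0.
apply: (@le_lt_trans _ _ (\int[mu01]_w (`|f w|%:E + `|g w|%:E))%E).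
  apply: ge0_le_integral => //.
  - apply/measurable_EFinP; apply: measurableT_comp => //.
    by apply: measurable_funB; exact: measurable_Lp.
  - by apply: emeasurable_funD; exact: mn.
  - by move=> w _; rewrite -EFinD lee_fin ler_normB.
by rewrite ge0_integralD// lte_add_pinfty.
Qed.

Lemma counting_set1 (k : nat) : counting [set k] = 1%:E :> \bar R.
Proof. by rewrite /counting asboolT// fset_set1 cardfs1. Qed.

Lemma counting_symd_set1 (j k : nat) :
  (counting (symd [set j] [set k]) <= 2%:E :> \bar R)%E.
Proof.
rewrite /symd; apply: (le_trans (measureU2 _ _ _)) => //.
have -> : 2%:E = (counting [set j] + counting [set k] : \bar R)%E.
  by rewrite !counting_set1 -EFinD.
by apply: leeD; apply: le_measure; rewrite ?inE.
Qed.

Lemma counting_setD1 (j k : nat) : j <> k ->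
  counting ([set j] `\` [set k]) = 1%:E :> \bar R.
Proof.
move=> jk; rewrite (_ : _ `\` _ = [set j]) ?counting_set1//.
by apply/seteqP; split => [l []//|l ->]; split.
Qed.
End CutMeasures.

(** * The kernel on the wreath product *)
Section WreathKernel.
Context {R : realType} {G H : groupType} (S : seq G) (T : seq H).
Hypotheses (genS : generates S) (genT : generates T).
Implicit Types (u v : wreath G H).
Local Notation W := (wreath_gens S T).
Local Notation genW := (generates_wreath genS genT).

Lemma wreath_base_dist_le d (Om : measurableType d)
    (mu : {measure set Om -> \bar R}) (P : H -> set Om)
    (code : wreath G H -> nat) (C : R) : 0 <= C ->
  (forall x, measurable (P x)) -> injective code ->
  (forall x t, t \in T -> (mu (symd (P x) (P (x * t)%g)) <= C%:E)%E) ->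
  forall u v, (layer_dist mu (base_layer P code u) (base_layer P code v)
    <= (C * (word_dist W u v)%:R)%:E)%E.
Proof.
move=> C0 mP cI PC; apply: word_dist_lipschitz; first exact: genW.
- by move=> u; exact: layer_distxx.
- by move=> u v; exact: layer_distC.
- by move=> u v w; apply: layer_distD => k; exact: measurable_base_layer.
move=> u s; rewrite mem_cat => /orP[/mapP[t tT ->]|/mapP[a aS ->]].
  have -> : (u * wreath_base t)%g = (u.1, (u.2 * t)%g) :> wreath G H.
    by apply: wreath_eqP => // z; rewrite wreath_mulE1 /= fsfun0E mulg1.
  by apply: le_trans (PC _ _ tT); exact: base_dist_move.
rewrite base_dist_lamp ?lee_fin//; first by rewrite /= mulg1.
move=> z zu.
rewrite wreath_mulE1 wreath_lampE; case: eqP => [/eqP|_]; last by rewrite mulg1.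
by rewrite -(inj_eq (mulgI u.2)) mulVKg mulg1 (negbTE zu).
Qed.

Lemma wreath_lamp_dist_le d (Om : measurableType d)
    (mu : {measure set Om -> \bar R}) (P : G -> set Om)
    (code : H -> nat) (C : R) : 0 <= C ->
  (forall x, measurable (P x)) -> injective code ->
  (forall a s, s \in S -> (mu (symd (P a) (P (a * s)%g)) <= C%:E)%E) ->
  forall u v, (layer_dist mu (lamp_layer P code u) (lamp_layer P code v)
    <= (C * (word_dist W u v)%:R)%:E)%E.
Proof.
move=> C0 mP cI PC; apply: word_dist_lipschitz; first exact: genW.
- by move=> u; exact: layer_distxx.
- by move=> u v; exact: layer_distC.
- by move=> u v w; apply: layer_distD => k; exact: measurable_lamp_layer.
move=> u s; rewrite mem_cat => /orP[/mapP[t tT ->]|/mapP[a aS ->]].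
  have -> : (u * wreath_base t)%g = (u.1, (u.2 * t)%g) :> wreath G H.
    by apply: wreath_eqP => // z; rewrite wreath_mulE1 /= fsfun0E mulg1.
  by rewrite lamp_dist_move.
apply: le_trans (PC (u.1 u.2) _ aS).
have -> : (u.1 u.2 * a)%g = (u * wreath_lamp a)%g.1 u.2.
  by rewrite wreath_mulE1 wreath_lampE mulVg eqxx.
apply: lamp_dist_lamp => // z zu.
rewrite wreath_mulE1 wreath_lampE; case: eqP => [/eqP|_]; last by rewrite mulg1.
by rewrite -(inj_eq (mulgI u.2)) mulVKg mulg1 (negbTE zu).
Qed.

Lemma coarse_gen (K : groupType) (V : seq K) (f : K -> L1 R) (r1 r2 : nat -> R) :
  control r2 -> coarse_bounds (word_dist V) L1_dist f r1 r2 ->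
  forall x t, t \in V -> L1_dist (f x) (f (x * t)%g) <= r2 1%N.
Proof.
move=> [_ r2m _] fV x t tV; have /andP[_ /le_trans] := fV x (x * t)%g; apply.
exact/r2m/word_dist_gen.
Qed.

(** The kernel is a sum of five: marks for the half-spaces [P1] given by [psi],
    for their complements [P2] and for the singletons [P3], and lamps measured by
    [phi] and by the discrete metric. The complements are needed because
    [base_dist_ge] sees only the half-spaces that contain [u.2]; the two discrete
    kernels detect that the positions differ, and count the lamps that differ. *)
Lemma wreath_kernel (psi : H -> L1 R) (phi : G -> L1 R)
    (rho1 rho2 tau1 tau2 : nat -> R) (decode : nat -> wreath G H) :
  control rho2 -> control tau2 ->
  coarse_bounds (word_dist T) L1_dist psi rho1 rho2 ->
  coarse_bounds (word_dist S) L1_dist phi tau1 tau2 ->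
  exists (D : wreath G H -> wreath G H -> R) (C : R),
  [/\ 0 < C, is_cut_kernel (fun i j => D (decode i) (decode j)),
    forall u v, 0 <= D u v <= C * (word_dist W u v)%:R &
    forall u v r, uniq r -> (forall z, (z \in r) = (u.1 z != v.1 z)) ->
    [/\ forall z, z = v.2 \/ z \in r -> rho1 (word_dist T u.2 z) <= D u v,
        u.2 <> v.2 -> 1 <= D u v,
        (size r)%:R <= D u v &
        \sum_(z <- r) tau1 (word_dist S (u.1 z) (v.1 z)) <= D u v]].
Proof.
move=> crho2 ctau2 psiP phiP.
have [codeW [decW codeWK]] := generated_enum genW.
have [codeG [decG codeGK]] := generated_enum genS.
have [codeH [decH codeHK]] := generated_enum genT.
have cWI := can_inj codeWK; have cGI := can_inj codeGK; have cHI := can_inj codeHK.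
pose P1 x := subgraph (psi x); pose P2 x := ~` P1 x.
pose P3 x : set nat := [set codeH x].
pose P4 a := subgraph (phi a); pose P5 a : set nat := [set codeG a].
have mP1 x : measurable (P1 x) by apply: measurable_subgraph; exact: measurable_Lp.
have mP2 x : measurable (P2 x) by exact: measurableC.
have mP3 x : measurable (P3 x) by [].
have mP4 a : measurable (P4 a) by apply: measurable_subgraph; exact: measurable_Lp.
have mP5 a : measurable (P5 a) by [].
have P2D x y : P2 x `\` P2 y = P1 y `\` P1 x.
  by rewrite /P2 !setDE setCK setIC.
pose count : {measure set nat -> \bar R} := @counting nat R.
pose K1 u v := layer_dist plane_measure (base_layer P1 codeW u) (base_layer P1 codeW v).
pose K2 u v := layer_dist plane_measure (base_layer P2 codeW u) (base_layer P2 codeW v).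
pose K3 u v := layer_dist count (base_layer P3 codeW u) (base_layer P3 codeW v).
pose K4 u v := layer_dist plane_measure (lamp_layer P4 codeH u) (lamp_layer P4 codeH v).
pose K5 u v := layer_dist count (lamp_layer P5 codeH u) (lamp_layer P5 codeH v).
have rho20 : 0 <= rho2 1%N by case: crho2 => <- rm _; exact: rm.
have tau20 : 0 <= tau2 1%N by case: ctau2 => <- rm _; exact: rm.
have H1 u v : (K1 u v <= (rho2 1%N * (word_dist W u v)%:R)%:E)%E.
  apply: wreath_base_dist_le => // x t tT.
  by rewrite measure_symd_subgraph lee_fin (coarse_gen crho2 psiP).
have H2 u v : (K2 u v <= (rho2 1%N * (word_dist W u v)%:R)%:E)%E.
  apply: wreath_base_dist_le => // x t tT.
  rewrite (_ : symd (P2 x) _ = symd (P1 x) (P1 (x * t)%g)); last first.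
    by rewrite /symd !P2D setUC.
  by rewrite measure_symd_subgraph lee_fin (coarse_gen crho2 psiP).
have H3 u v : (K3 u v <= (2 * (word_dist W u v)%:R)%:E)%E.
  by apply: wreath_base_dist_le => // x t tT; exact: counting_symd_set1.
have H4 u v : (K4 u v <= (tau2 1%N * (word_dist W u v)%:R)%:E)%E.
  apply: wreath_lamp_dist_le => // x t tT.
  by rewrite measure_symd_subgraph lee_fin (coarse_gen ctau2 phiP).
have H5 u v : (K5 u v <= (2 * (word_dist W u v)%:R)%:E)%E.
  by apply: wreath_lamp_dist_le => // x t tT; exact: counting_symd_set1.
have fin (x : \bar R) (y : R) : (0 <= x -> x <= y%:E -> x = (fine x)%:E)%E.
  by case: x.
have F1 u v : K1 u v = (fine (K1 u v))%:E by apply: fin (H1 u v); exact: layer_dist_ge0.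
have F2 u v : K2 u v = (fine (K2 u v))%:E by apply: fin (H2 u v); exact: layer_dist_ge0.
have F3 u v : K3 u v = (fine (K3 u v))%:E by apply: fin (H3 u v); exact: layer_dist_ge0.
have F4 u v : K4 u v = (fine (K4 u v))%:E by apply: fin (H4 u v); exact: layer_dist_ge0.
have F5 u v : K5 u v = (fine (K5 u v))%:E by apply: fin (H5 u v); exact: layer_dist_ge0.
have C1 : is_cut_kernel (fun i j => fine (K1 (decode i) (decode j))).
  by apply: layer_cut_kernel => [i k|i j]; [exact: measurable_base_layer
    |rewrite -/(K1 _ _) F1 ltry].
have C2 : is_cut_kernel (fun i j => fine (K2 (decode i) (decode j))).
  by apply: layer_cut_kernel => [i k|i j]; [exact: measurable_base_layer
    |rewrite -/(K2 _ _) F2 ltry].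
have C3 : is_cut_kernel (fun i j => fine (K3 (decode i) (decode j))).
  by apply: layer_cut_kernel => [i k|i j]; [exact: measurable_base_layer
    |rewrite -/(K3 _ _) F3 ltry].
have C4 : is_cut_kernel (fun i j => fine (K4 (decode i) (decode j))).
  by apply: layer_cut_kernel => [i k|i j]; [exact: measurable_lamp_layer
    |rewrite -/(K4 _ _) F4 ltry].
have C5 : is_cut_kernel (fun i j => fine (K5 (decode i) (decode j))).
  by apply: layer_cut_kernel => [i k|i j]; [exact: measurable_lamp_layer
    |rewrite -/(K5 _ _) F5 ltry].
have L12 u v z : u.2 = z \/ u.1 z <> v.1 z \/ v.2 = z ->
    ((rho1 (word_dist T u.2 z))%:E <= K1 u v + K2 u v)%E.
  move=> uz; have /andP[psiz _] := psiP u.2 z.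
  apply: (@le_trans _ _ (L1_dist (psi u.2) (psi z))%:E); first by rewrite lee_fin.
  rewrite -measure_symd_subgraph.
  apply: (le_trans (measureU2 _ (measurableD (mP1 u.2) (mP1 z))
    (measurableD (mP1 z) (mP1 u.2)))).
  apply: leeD; first exact: base_dist_ge.
  by rewrite -/(P1 z) -/(P1 u.2) -P2D; exact: base_dist_ge.
have L3 u v : u.2 <> v.2 -> (1%:E <= K3 u v)%E.
  move=> uv; rewrite -(@counting_setD1 _ (codeH u.2) (codeH v.2)).
    by apply: base_dist_ge => //; right; right.
  by move/cHI.
have L4 u v r : uniq r ->
    ((\sum_(z <- r) tau1 (word_dist S (u.1 z) (v.1 z)))%:E <= K4 u v)%E.
  move=> ur; apply: le_trans (lamp_dist_ge plane_measure P4 cHI u v ur).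
  rewrite -sumEFin; apply: lee_sum => z _.
  rewrite measure_symd_subgraph lee_fin.
  by have /andP[] := phiP (u.1 z) (v.1 z).
have L5 u v r : uniq r -> (forall z, (z \in r) = (u.1 z != v.1 z)) ->
    ((size r)%:R%:E <= K5 u v)%E.
  move=> ur rE; apply: le_trans (lamp_dist_ge count P5 cHI u v ur).
  rewrite -sum1_size natr_sum -sumEFin big_seq [leRHS]big_seq.
  apply: lee_sum => z; rewrite rE => /eqP zuv.
  rewrite -(@counting_setD1 _ (codeG (u.1 z)) (codeG (v.1 z))); last by move/cGI.
  by apply: le_measure; rewrite ?inE//; exact: subsetUl.
have [g1 [g2 [g3 [g4 g5]]]] : (forall u v, 0 <= fine (K1 u v)) /\
    (forall u v, 0 <= fine (K2 u v)) /\ (forall u v, 0 <= fine (K3 u v)) /\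
    (forall u v, 0 <= fine (K4 u v)) /\ (forall u v, 0 <= fine (K5 u v)).
  by do 4 ?[split]; move=> u v; apply: fine_ge0; apply: layer_dist_ge0.
clearbody K1 K2 K3 K4 K5.
exists (fun u v => fine (K1 u v) + fine (K2 u v) + fine (K3 u v) + fine (K4 u v)
  + fine (K5 u v)), (rho2 1%N + rho2 1%N + 2 + tau2 1%N + 2); split.
- lra.
- by do 4 ?[apply: is_cut_kernelD].
- move=> u v; apply/andP; split; first by rewrite !addr_ge0.
  have := (H1 u v, H2 u v, H3 u v, H4 u v, H5 u v).
  rewrite F1 F2 F3 F4 F5 !lee_fin => -[[[[h1 h2] h3] h4] h5].
  lra.
move=> u v r ur rE; have := (g1 u v, g2 u v, g3 u v, g4 u v, g5 u v).
move=> [[[[h1 h2] h3] h4] h5]; split.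
- move=> z zr; have hz : u.2 = z \/ u.1 z <> v.1 z \/ v.2 = z.
    by case: zr => [->|]; [right; right|rewrite rE => /eqP; right; left].
  by have := L12 u v z hz; rewrite F1 F2 -EFinD lee_fin; lra.
- by move=> uv; have := L3 u v uv; rewrite F3 lee_fin; lra.
- by have := L5 u v r ur rE; rewrite F5 lee_fin; lra.
- by have := L4 u v r ur; rewrite F4 lee_fin; lra.
Qed.

End WreathKernel.

(** * The functions min_split and min_sqrt_split *)
Section Splittings.
Context {R : realType}.
Implicit Types (rho tau : nat -> R).

Lemma control_ge0 rho k : control rho -> 0 <= rho k.
Proof. by move=> [<- rm _]; exact: rm. Qed.

(** Upper bounds on a distance yield parts with too large a sum; they may be
    shrunk as [rho] is nondecreasing. *)
Lemma shrink_parts rho (s : seq nat) (t : nat) : {homo rho : m n / (m <= n)%N >-> m <= n} ->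
  (t <= sumn s)%N -> exists s' : seq nat,
    [/\ size s' = size s, sumn s' = t & \sum_(k <- s') rho k <= \sum_(k <- s) rho k].
Proof.
move=> rm; elim: s t => [|a s ih] t /= ts.
  by exists [::]; split => //=; lia.
have [|s' [ss' sum' le']] := ih (t - minn t a)%N; first by lia.
exists (minn t a :: s'); split; rewrite /= ?ss' ?sum'//; first by lia.
by rewrite !big_cons lerD// rm// geq_minr.
Qed.

Lemma min_split_le rho (s : seq nat) : control rho -> (0 < size s)%N ->
  min_split rho (sumn s) <= \sum_(k <- s) rho k.
Proof.
move=> cr s0; apply: ge_inf; last by exists s.
by exists 0 => _ [s' _ <-]; apply: sumr_ge0 => k _; exact: control_ge0.
Qed.

Lemma min_sqrt_split_ge0 rho tau t : control tau -> 0 <= min_sqrt_split rho tau t.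
Proof.
move=> ct; apply: lb_le_inf.
  by exists (Num.sqrt (min_split rho t) + \sum_(k <- [::]) tau k), (t, [::]) => //=; rewrite addn0.
move=> _ [s _ <-]; rewrite addr_ge0 ?sqrtr_ge0//.
by apply: sumr_ge0 => k _; exact: control_ge0.
Qed.

Lemma min_sqrt_split_le rho tau (s1 s2 : seq nat) t : control rho -> control tau ->
  (0 < size s1)%N -> (t <= sumn s1 + sumn s2)%N ->
  min_sqrt_split rho tau t <=
    Num.sqrt (\sum_(k <- s1) rho k) + \sum_(k <- s2) tau k.
Proof.
move=> cr ct s10 ts.
have [_ rm _] := cr; have [_ tm _] := ct.
have [|s1' [z1 sum1 le1]] := @shrink_parts _ s1 (minn t (sumn s1)) rm; first by lia.
have [|s2' [z2 sum2 le2]] := @shrink_parts _ s2 (t - minn t (sumn s1)) tm; first by lia.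
apply: (@le_trans _ _ (Num.sqrt (min_split rho (sumn s1')) + \sum_(k <- s2') tau k)).
  apply: ge_inf; last by exists (sumn s1', s2') => //=; lia.
  exists 0 => _ [s _ <-]; rewrite addr_ge0 ?sqrtr_ge0//.
  by apply: sumr_ge0 => k _; exact: control_ge0.
apply: lerD => //; apply: ler_wsqrtr; apply: le_trans le1.
by apply: min_split_le => //; rewrite z1.
Qed.

(** With [k = size r], the values of [rho] on the parts [a] and, twice, [x.1] add up
    to at most [D + 2 k D <= 4 D ^+ 2], unless there is nothing to split. *)
Lemma min_sqrt_split_star rho tau (D : R) t a (r : seq (nat * nat)) :
  control rho -> control tau ->
  (t <= \sum_(x <- r) (x.1 * 2 + x.2) + a)%N -> 0 <= D ->
  rho a <= D -> ((0 < a)%N -> 1 <= D) -> (size r)%:R <= D ->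
  (forall x, x \in r -> rho x.1 <= D) -> \sum_(x <- r) tau x.2 <= D ->
  min_sqrt_split rho tau t <= 3 * D.
Proof.
move=> cr ct tle D0 ra Da Dr rD tD.
pose s1 := a :: ([seq x.1 | x <- r] ++ [seq x.1 | x <- r]).
have le : min_sqrt_split rho tau t <= Num.sqrt (\sum_(k <- s1) rho k)
    + \sum_(k <- [seq x.2 | x <- r]) tau k.
  apply: min_sqrt_split_le => //; apply: leq_trans tle _.
  rewrite /= sumn_cat !sumnE !big_map big_split/= -big_distrl/=; lia.
rewrite big_cons big_cat/= !big_map in le.
apply: (le_trans le).
have S1 : \sum_(x <- r) rho x.1 <= (size r)%:R * D.
  apply: (@le_trans _ _ (\sum_(x <- r) D)).
    by rewrite big_seq [leRHS]big_seq; exact: ler_sum.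
  by rewrite big_const_seq count_predT iter_addr_0 mulr_natl.
have [/andP[/eqP a0 /eqP r0]|nz] := boolP ((a == 0%N) && (r == [::])).
  by case: cr => r00 _ _; rewrite r0 a0 !big_nil r00 !addr0 sqrtr0 mulr_ge0.
have D1 : 1 <= D.
  move: nz; rewrite negb_and -lt0n => /orP[/Da//|r0].
  by apply: le_trans Dr; rewrite ler1n lt0n size_eq0.
rewrite (_ : 3 * D = 2 * D + D); last by ring.
apply: lerD => //; rewrite -[leRHS]ger0_norm ?mulr_ge0// -sqrtr_sqr.
by apply: ler_wsqrtr; nra.
Qed.
End Splittings.

(** * Coarse embeddings *)
Section WreathEmbedding.
Context {R : realType}.

(** The lower control function at [t] is the infimum of [delta] over the pairs at
    distance at least [t]; including [t] itself keeps it finite if there are none. *)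
Lemma control_of_proper (X : Type) (dX : X -> X -> nat) (delta : X -> X -> R) :
  (forall u v, 0 <= delta u v) ->
  (forall M, exists B, forall u v, delta u v <= M -> (dX u v <= B)%N) ->
  exists2 rho : nat -> R, control rho & forall u v, rho (dX u v) <= delta u v.
Proof.
move=> d0 prop.
pose V t := [set x | x = t%:R \/ exists u v, (t <= dX u v)%N /\ x = delta u v].
have V0 t : lbound (V t) 0 by move=> x [->|[u [v [_ ->]]]].
have Vn t : V t !=set0 by exists t%:R; left.
exists (fun t => inf (V t)); last first.
  move=> u v; apply: ge_inf; first by exists 0; exact: V0.
  by right; exists u, v.
split.
- apply/eqP; rewrite eq_le; apply/andP; split.
    by apply: ge_inf; [exists 0; exact: V0|left].
  by apply: lb_le_inf; [exact: Vn|exact: V0].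
- move=> s t st; apply: lb_le_inf => // x [->|[u [v [tuv ->]]]].
    apply: (@le_trans _ _ s%:R); last by rewrite ler_nat.
    by apply: ge_inf; [exists 0; exact: V0|left].
  apply: ge_inf; first by exists 0; exact: V0.
  by right; exists u, v; split => //; exact: leq_trans tuv.
- move=> M; have [B BP] := prop M; exists (maxn B.+1 (Num.bound `|M|)).
  apply: lb_le_inf => // x [->|[u [v [tuv ->]]]].
    apply: le_trans (ler_norm _) _; apply: le_trans (ltW (archi_boundP _)) _ => //.
    by rewrite ler_nat leq_maxr.
  rewrite leNgt; apply/negP => /ltW /BP; rewrite leqNgt => /negP; apply.
  by apply: leq_trans tuv; exact: leq_maxl.
Qed.

Lemma control_bound rho (M : R) : control rho ->
  exists n, forall k, rho k <= M -> (k <= n)%N.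
Proof.
move=> [_ rm ru]; have [n Mn] := ru (M + 1); exists n => k kM.
rewrite leqNgt; apply/negP => /ltnW/rm; lra.
Qed.

Variables (G H : groupType) (S : seq G) (T : seq H) (p : R) (p1 : 1 <= p).
Hypotheses (genS : generates S) (genT : generates T).
Local Notation W := (wreath_gens S T).

Lemma nu_exp_gt0 : 0 < nu_exp p.
Proof. by rewrite /nu_exp lt_max divr_gt0. Qed.

Lemma wreath_Lp (psi : H -> L1 R) (phi : G -> L1 R)
    (rho1 rho2 tau1 tau2 : nat -> R) :
  control rho1 -> control rho2 -> control tau1 -> control tau2 ->
  coarse_bounds (word_dist T) L1_dist psi rho1 rho2 ->
  coarse_bounds (word_dist S) L1_dist phi tau1 tau2 ->
  exists (D : wreath G H -> wreath G H -> R) (Phi : wreath G H -> Lp p1) (c C : R),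
  [/\ 0 < c, 0 < C,
    forall u v, c * D u v `^ nu_exp p <= Lp_dist (Phi u) (Phi v)
      <= C * nu2 p (word_dist W u v),
    forall u v, 0 <= D u v /\
      min_sqrt_split rho1 tau1 (word_dist W u v) <= 3 * D u v &
    forall M, exists B, forall u v, D u v <= M -> (word_dist W u v <= B)%N].
Proof.
move=> cr1 cr2 ct1 ct2 psiP phiP.
have genW := generates_wreath genS genT.
have [code [decode codeK]] := generated_enum genW.
have [D [C [C0 cutD DC DL]]] :=
  wreath_kernel genS genT decode cr2 ct2 psiP phiP.
have [Phi [c1 [C1 [c10 C10 PhiP]]]] := cut_kernel_Lp p1 cutD.
have e0 := nu_exp_gt0.
exists D, (Phi \o code), c1, (C1 * C `^ nu_exp p).
split=> //; first by rewrite mulr_gt0// powR_gt0.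
- move=> u v; have := PhiP (code u) (code v); rewrite !codeK => /andP[-> /=].
  move=> /le_trans; apply; rewrite -mulrA ler_pM2l// -powRM ?(ltW C0)//.
  have /andP[D0 Dle] := DC u v.
  by apply: ge0_ler_powR; rewrite ?nnegrE ?(ltW e0)// mulr_ge0// ltW.
- move=> u v; have /andP[D0 _] := DC u v; split=> //.
  have [r ur rE] := diff_support u v; have [Dz Duv Dr Dt] := DL u v r ur rE.
  apply: (@min_sqrt_split_star _ _ _ _ _ (word_dist T u.2 v.2)
    [seq (word_dist T u.2 z, word_dist S (u.1 z) (v.1 z)) | z <- r]) => //.
  + by rewrite big_map; exact: wreath_dist_le.
  + by apply: Dz; left.
  + move=> d0; apply: Duv => uv; move: d0; rewrite uv /word_dist mulVg.
    by rewrite ltnNge word_length_le//; exact: has_word1.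
  + by rewrite size_map.
  + by move=> _ /mapP[z zr ->]; apply: Dz; right.
  + by rewrite big_map.
move=> M.
have [nr nrP] := control_bound M cr1; have [nt ntP] := control_bound M ct1.
pose K := Num.bound `|M|.
exists (K * (nr * 2 + nt) + nr)%N => u v DM.
have [r ur rE] := diff_support u v; have [Dz _ Dr Dt] := DL u v r ur rE.
apply: leq_trans (wreath_dist_le genS genT ur rE) _; apply: leq_add; last first.
  by apply: nrP; apply: le_trans DM; apply: Dz; left.
have rK : (size r <= K)%N.
  rewrite -(ler_nat R); apply: le_trans Dr _; apply: le_trans DM _.
  by apply: le_trans (ler_norm _) _; apply/ltW/archi_boundP.
apply: (@leq_trans (size r * (nr * 2 + nt))); last by rewrite leq_mul2r rK orbT.
rewrite -sum1_size big_distrl/= big_seq [leqRHS]big_seq; apply: leq_sum => z zr.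
rewrite mul1n leq_add// ?leq_mul2r/=.
  by apply: nrP; apply: le_trans DM; apply: Dz; right.
apply: ntP; apply: le_trans DM; apply: le_trans Dt.
rewrite (big_rem z)//= lerDl; apply: sumr_ge0 => k _; exact: control_ge0.
Qed.

End WreathEmbedding.

Theorem theorem1p2 (R : realType) (G H : groupType) (S : seq G) (T : seq H)
    (p : R) (p1 : 1 <= p)
    (infG : infinite_set [set: G]) (infH : infinite_set [set: H])
    (genS : generates S) (genT : generates T) :
  (embeds_coarsely (word_dist S) (@L1_dist R) ->
   embeds_coarsely (word_dist T) (@L1_dist R) ->
   embeds_coarsely (word_dist (wreath_gens S T)) (@Lp_dist R p p1))
  /\
  (forall (psi : H -> L1 R) (phi : G -> L1 R)
      (rho1 rho2 tau1 tau2 : nat -> R),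
    control rho1 -> control rho2 -> control tau1 -> control tau2 ->
    coarse_bounds (word_dist T) L1_dist psi rho1 rho2 ->
    coarse_bounds (word_dist S) L1_dist phi tau1 tau2 ->
    exists (Phi : wreath G H -> Lp p1) (c C : R),
      [/\ 0 < c, 0 < C
        & forall u v : wreath G H,
            let t := word_dist (wreath_gens S T) u v in
            c * nu1 p rho1 tau1 t <= Lp_dist (Phi u) (Phi v)
              <= C * nu2 p t]).
Proof.
have p0 : 0 < p := lt_le_trans ltr01 p1.
have e0 := nu_exp_gt0 p; have e0' := ltW e0.
split.
  move=> [phi [tau1 [tau2 [ct1 ct2 phiP]]]] [psi [rho1 [rho2 [cr1 cr2 psiP]]]].
  have [D [Phi [c [C [c0 C0 PhiP DP Dproper]]]]] :=
    wreath_Lp p1 genS genT cr1 cr2 ct1 ct2 psiP phiP.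
  have Phi_ge0 u v : 0 <= Lp_dist (Phi u) (Phi v).
    have /andP[+ _] := PhiP u v; apply: le_trans.
    by rewrite mulr_ge0 ?powR_ge0// ltW.
  have [|rho crho rhoP] := @control_of_proper _ _ (word_dist (wreath_gens S T))
    (fun u v => Lp_dist (Phi u) (Phi v)) Phi_ge0.
    move=> M; have [B BP] := Dproper ((`|M| / c) `^ (nu_exp p)^-1).
    exists B => u v uvM; apply: BP; have [D0 _] := DP u v.
    have DM : D u v `^ nu_exp p <= `|M| / c.
      rewrite ler_pdivlMr// mulrC; have /andP[+ _] := PhiP u v.
      by move=> /le_trans; apply; apply: le_trans uvM (ler_norm _).
    rewrite -[leLHS]powRr1// -(mulfV (lt0r_neq0 e0)) powRrM.
    apply: ge0_ler_powR; rewrite ?nnegrE ?invr_ge0 ?powR_ge0//.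
    by rewrite divr_ge0// ltW.
  exists Phi, rho, (fun t => C * nu2 p t + t%:R); split=> //.
    split.
    - by rewrite /nu2 powR0 ?gt_eqF// mulr0 addr0.
    - move=> s t st; rewrite lerD ?ler_nat// ler_pM2l// /nu2.
      by apply: ge0_ler_powR; rewrite ?nnegrE// ler_nat.
    - move=> M; exists (Num.bound `|M|).
      apply: le_trans (ler_norm _) _; apply: le_trans (ltW (archi_boundP _)) _ => //.
      by rewrite lerDr mulr_ge0 ?powR_ge0// ltW.
  move=> u v; rewrite rhoP /=; have /andP[_ /le_trans] := PhiP u v; apply.
  by rewrite lerDl.
move=> psi phi rho1 rho2 tau1 tau2 cr1 cr2 ct1 ct2 psiP phiP.
have [D [Phi [c [C [c0 C0 PhiP DP _]]]]] :=
  wreath_Lp p1 genS genT cr1 cr2 ct1 ct2 psiP phiP.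
have t0 : 0 < 3 `^ nu_exp p by rewrite powR_gt0.
exists Phi, (c / 3 `^ nu_exp p), C; split=> // [|u v]; first by rewrite divr_gt0.
rewrite /=; have /andP[lo ->] := PhiP u v; rewrite andbT; apply: le_trans lo.
have [D0 DL] := DP u v.
rewrite -mulrA ler_pM2l// ler_pdivrMl// -powRM// /nu1.
by apply: ge0_ler_powR; rewrite ?nnegrE ?min_sqrt_split_ge0 ?mulr_ge0.
Qed.
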